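(* Suppose that $M$ and $N$ are $3$-connected matroids such that $|E(N)| \geq 4$, and $C^{*}$ is a cocircuit of $M$ with the property that $M / x_{0}$ has an $N$-minor for some $x_{0} \in C^{*}$. Then at least one of the following holds: (i) there is an element $x \in C^{*}$ such that $\operatorname{si}(M / x)$ is $3$-connected and has an $N$-minor; (ii) there is a four-element fan $(x_{1}, x_{2}, x_{3}, x_{4})$ of $M$ such that $x_{1}, x_{3} \in C^{*}$, and $\operatorname{si}(M / x_{2})$ is $3$-connected with an $N$-minor; (iii) there is a segment-cosegment pair $(L, L^{*})$ of $M$, with $L = \{x_1,\ldots,x_t\}$ and $L^{*} = \{y_1,\ldots,y_t\}$, such that $L \subseteq C^{*}$, and $\operatorname{cl}(L) - L$ contains a single element $e$; in this case $e \notin C^{*}$ and $\operatorname{si}(M / e)$ is $3$-connected with an $N$-minor; moreover $M / \operatorname{cl}(L)$ is $3$-connected with an $N$-minor, and if $x_{i} \in L$ then $M / x_{i}$ is $3$-connected up to a unique spore $(\operatorname{cl}(L) - \{x_{i}\}, y_{i})$; or (iv) there is a segment-cosegment pair $(L, L^{*})$ of $M$, with $L = \{x_1,\ldots,x_t\}$ and $L^{*} = \{y_1,\ldots,y_t\}$, such that $L$ is a flat of $M$ and $|L - C^{*}| \leq 1$; in this case $M / L$ is $3$-connected with an $N$-minor, and if $x_{i} \in L$ then $M / x_{i}$ is $3$-connected up to a unique spore $(L - \{x_{i}\}, y_{i})$.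
   Context: All matroids are finite. For a matroid $M$ with ground set $E$, rank function $r$ and closure operator $\operatorname{cl}$, the connectivity function is $\lambda_M(X) = r(X) + r(E - X) - r(M)$ for $X \subseteq E$. A $k$-separation of $M$ is a partition $(X, E-X)$ of $E$ with $\lambda_M(X) < k$ and $|X|, |E-X| \geq k$. $M$ is $n$-connected if it has no $k$-separation for any $k < n$ ($k$ a positive integer). $\operatorname{si}(M)$ is the simple matroid associated with $M$ (delete all loops and all but one element of each parallel class). A matroid has an $N$-minor if it has a minor isomorphic to $N$. A triangle is a three-element circuit and a triad is a three-element cocircuit. A four-element fan of $M$ is a sequence $(x_1,x_2,x_3,x_4)$ of distinct elements of $E(M)$ such that $\{x_1,x_2,x_3\}$ is a triangle and $\{x_2,x_3,x_4\}$ is a triad. A segment of $M$ is a set $L \subseteq E(M)$ with $|L| \geq 3$ such that every three-element subset of $L$ is a triangle of $M$. A segment-cosegment pair of $M$ is a pair $(L, L^{*})$ where $L = \{x_1,\ldots,x_t\}$ is a segment of $M$ and $L^{*} = \{y_1,\ldots,y_t\}$ is a set such that $L \cap L^{*} = \emptyset$ and, for every $i \in \{1,\ldots,t\}$, the set $(\operatorname{cl}(L) - \{x_i\}) \cup \{y_i\}$ is a cocircuit of $M$. A spore of a matroid is a pair $(P, s)$ such that $P$ is a rank-one flat, $s$ is an element of the ground set, and $P \cup \{s\}$ is a cocircuit. A matroid $M$ is $3$-connected up to a unique spore $(P,s)$ if $(P,s)$ is the only spore of $M$, and whenever $(X, Y)$ is a $k$-separation of $M$ for some $k < 3$, then either $X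 \subseteq P \cup \{s\}$ or $Y \subseteq P \cup \{s\}$. *)

(* Defs.v *)
From mathcomp Require Import all_boot.
From mathcomp Require Import zify.

Set Implicit Arguments.
Unset Strict Implicit.
Unset Printing Implicit Defensive.

(* Finite matroids, given by a ground set inside a finite type and a rank
   function satisfying the usual rank axioms.  The rank function is total on
   {set T}; rk_ground makes elements outside the ground set irrelevant to it,
   so that the axioms over all sets amount to those over subsets of the ground
   set. *)
Record matroid (T : finType) := Matroid {
  ground : {set T};
  rk : {set T} -> nat;
  rk_ground : forall X : {set T}, rk X = rk (X :&: ground);
  rk_le_card : forall X : {set T}, rk X <= #|X|;
  rk_mono : forall X Y : {set T}, X \subset Y -> rk X <= rk Y;
  rk_submod : forall X Y : {set T},
    rk (X :|: Y) + rk (X :&: Y) <= rk X + rk Y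
}.

Section Operations.
Variables (T : finType) (M : matroid T).
Local Notation E := (ground M).
Local Notation r := (rk M).
Implicit Types X Y C D : {set T}.

Section Delete.
Variable D : {set T}.
Let del_rk X := r (X :\: D).

Fact delete_rk_ground X : del_rk X = del_rk (X :&: (E :\: D)).
Proof.
rewrite /del_rk rk_ground [RHS]rk_ground; congr (r _).
by apply/setP=> z; rewrite !inE; case: (z \in D); case: (z \in X);
   case: (z \in E).
Qed.

Fact delete_rk_le_card X : del_rk X <= #|X|.
Proof. by rewrite (leq_trans (rk_le_card M _)) // subset_leq_card // subsetDl. Qed.

Fact delete_rk_mono X Y : X \subset Y -> del_rk X <= del_rk Y.
Proof. by move=> sXY; apply/rk_mono/setSD. Qed.

Fact delete_rk_submod X Y :
  del_rk (X :|: Y) + del_rk (X :&: Y) <= del_rk X + del_rk Y.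
Proof. by rewrite /del_rk setDUl setDIl rk_submod. Qed.

Definition delete : matroid T :=
  Matroid delete_rk_ground delete_rk_le_card delete_rk_mono delete_rk_submod.
End Delete.

Section Contract.
Variable C : {set T}.
Let con_rk X := r (X :|: C) - r C.

Fact contract_rk_ground X : con_rk X = con_rk (X :&: (E :\: C)).
Proof.
rewrite /con_rk rk_ground [in RHS]rk_ground; congr (r _ - _).
by apply/setP=> z; rewrite !inE; case: (z \in C); case: (z \in X);
   case: (z \in E).
Qed.

Fact contract_rk_le_card X : con_rk X <= #|X|.
Proof.
have := rk_submod M X C; have := rk_le_card M X; rewrite /con_rk; lia.
Qed.

Fact contract_rk_mono X Y : X \subset Y -> con_rk X <= con_rk Y.
Proof. by move=> sXY; apply/leq_sub2r/rk_mono/setSU. Qed.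

Fact contract_rk_submod X Y :
  con_rk (X :|: Y) + con_rk (X :&: Y) <= con_rk X + con_rk Y.
Proof.
have := rk_submod M (X :|: C) (Y :|: C).
rewrite -setUIl setUACA setUid /con_rk => sub.
have leC Z : r C <= r (Z :|: C) by apply/rk_mono/subsetUr.
have := leC X; have := leC Y; have := leC (X :|: Y); have := leC (X :&: Y).
lia.
Qed.

Definition contract : matroid T :=
  Matroid contract_rk_ground contract_rk_le_card contract_rk_mono
    contract_rk_submod.
End Contract.

Section Dual.
Let dual_rk X := #|X :&: E| + r (E :\: X) - r E.

Let dual_rk_ge X : r E <= #|X :&: E| + r (E :\: X).
Proof.
have := rk_submod M (X :&: E) (E :\: X).
have -> : (X :&: E) :|: (E :\: X) = E by rewrite setIC setID.
have := rk_le_card M (X :&: E); lia.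
Qed.

Fact dual_rk_ground X : dual_rk X = dual_rk (X :&: E).
Proof.
rewrite /dual_rk -setIA setIid; congr (_ + r _ - _).
by apply/setP=> z; rewrite !inE; case: (z \in X); case: (z \in E).
Qed.

Fact dual_rk_le_card X : dual_rk X <= #|X|.
Proof.
have := rk_mono M (subsetDl E X).
have := subset_leq_card (subsetIl X E); rewrite /dual_rk; lia.
Qed.

Fact dual_rk_mono X Y : X \subset Y -> dual_rk X <= dual_rk Y.
Proof.
move=> sXY; apply: leq_sub2r.
have := rk_submod M (E :\: Y) ((Y :&: E) :\: (X :&: E)).
have -> : (E :\: Y) :|: ((Y :&: E) :\: (X :&: E)) = E :\: X.
  apply/setP=> z; rewrite !inE; have := subsetP sXY z.
  by case: (z \in X); case: (z \in Y); case: (z \in E) => //= ->.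
have := rk_le_card M ((Y :&: E) :\: (X :&: E)).
have := cardsID (X :&: E) (Y :&: E).
rewrite (setIidPr (setSI E sXY)); lia.
Qed.

Fact dual_rk_submod X Y :
  dual_rk (X :|: Y) + dual_rk (X :&: Y) <= dual_rk X + dual_rk Y.
Proof.
have := dual_rk_ge X; have := dual_rk_ge Y.
have := dual_rk_ge (X :|: Y); have := dual_rk_ge (X :&: Y).
have := rk_submod M (E :\: X) (E :\: Y); rewrite -setDIr -setDUr.
have := cardsUI (X :&: E) (Y :&: E); rewrite -setIUl -setIIl.
rewrite /dual_rk; lia.
Qed.

Definition dual : matroid T :=
  Matroid dual_rk_ground dual_rk_le_card dual_rk_mono dual_rk_submod.
End Dual.

End Operations.

Section Notions.
Variable T : finType.
Implicit Types (M : matroid T) (X P L C : {set T}).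

Definition cl M X : {set T} :=
  [set e in ground M | rk M (e |: X) == rk M X].

Definition flat M X := (X \subset ground M) && (cl M X == X).

Definition dependent M X := (X \subset ground M) && (rk M X < #|X|).

Definition circuit M C := minset (dependent M) C.

Definition cocircuit M C := circuit (dual M) C.

Definition triangle M X := circuit M X && (#|X| == 3).

Definition triad M X := cocircuit M X && (#|X| == 3).

Definition connectivity M X :=
  rk M X + rk M (ground M :\: X) - rk M (ground M).

(* The k-separation (X, E - X) is represented by X. *)
Definition separation M (k : nat) X :=
  [&& X \subset ground M, connectivity M X < k, k <= #|X|
    & k <= #|ground M :\: X|].

Definition n_connected (n : nat) M : Prop :=
  forall (k : nat) X, 0 < k < n -> ~~ separation M k X.

Definition loop M (x : T) := circuit M [set x].

(* Made reflexive, so as to be an equivalence relation on non-loops. *)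
Definition parallel M (x y : T) := (x == y) || circuit M [set x; y].

Definition nonloops M : {set T} := [set x in ground M | ~~ loop M x].

Definition parallel_classes M : {set {set T}} :=
  equivalence_partition (parallel M) (nonloops M).

(* Keeps one (canonically chosen) element of each parallel class. *)
Definition si M : matroid T :=
  delete M (ground M :\: transversal (parallel_classes M) (nonloops M)).

Definition four_fan M (x1 x2 x3 x4 : T) :=
  [&& uniq [:: x1; x2; x3; x4], triangle M [set x1; x2; x3]
    & triad M [set x2; x3; x4]].

Definition segment M L : Prop :=
  [/\ L \subset ground M, 3 <= #|L|
    & forall X, X \subset L -> #|X| = 3 -> triangle M X].

(* The pair (L, L* ) with its matching x_i <-> y_i: L = {x_1, ..., x_t} and
   L* = {y_1, ..., y_t} are enumerated without repetition. *)
Definition segment_cosegment M (t : nat) (x y : 'I_t -> T) : Prop :=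
  let L := [set x i | i : 'I_t] in
  let Lstar := [set y i | i : 'I_t] in
  [/\ injective x, injective y, segment M L, [disjoint L & Lstar]
    & forall i : 'I_t, cocircuit M (y i |: (cl M L :\ x i))].

Definition spore M P (s : T) :=
  [&& flat M P, rk M P == 1, s \in ground M & cocircuit M (s |: P)].

Definition three_connected_up_to_unique_spore M P (s : T) : Prop :=
  [/\ spore M P s,
      forall P' s', spore M P' s' -> P' = P /\ s' = s
    & forall (k : nat) X, 0 < k < 3 -> separation M k X ->
        X \subset s |: P \/ ground M :\: X \subset s |: P].

End Notions.

(* The bijection has the ground set itself as its domain, so that the
   definition is also right for empty types. *)
Definition isomorphic (T U : finType) (M : matroid T) (N : matroid U) : Prop :=
  exists f : {x : T | x \in ground M} -> U,
    [/\ injective f, [set f z | z in [set: {x : T | x \in ground M}]] = ground N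
      & forall X : {set {x : T | x \in ground M}},
          rk N [set f z | z in X] = rk M [set val z | z in X]].

Definition has_minor (T U : finType) (M : matroid T) (N : matroid U) : Prop :=
  exists C D : {set T},
    [/\ C \subset ground M, D \subset ground M, [disjoint C & D]
      & isomorphic (delete (contract M C) D) N].

(* Main.v *)
Require Import Defs.
From mathcomp Require Import all_boot.
From Stdlib Require Import Classical.
From mathcomp Require Import zify.

(** Contracting [x] destroys 3-connectivity up to parallel classes exactly when
    [M] has a vertical 3-partition [(X, x, Y)]; since [N] is 3-connected, one
    side, say [X], carries at most one element of the minor, and then every
    element of [X] outside the closure of [Y] can also be contracted.  Assume
    that (i) and (ii) fail, and choose such a triple with [x] in [C*] and [X]
    minimal.  For [y] in [X] and [C*] there is again a vertical 3-partition at
    [y]; uncrossing the two confines most quadrants to lines, and produces a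
    line [L] and a point [v] such that [(L - y) + v] is a cocircuit.  The triples
    with [X = (L - x) + v] need a second pass, in which [X] is minimal among the
    other ones: otherwise some elements of [L] could fail to have a partner [v].
    In the end every element of [L] in [C*] has a partner.  The at most one
    element [e] of [L] outside [C*] either has a partner too, giving (iv), or
    has a 3-connected [si (M / e)], giving (iii) if [|L| > 3] and (ii)
    otherwise. *)

Set Implicit Arguments.
Unset Strict Implicit.
Unset Printing Implicit Defensive.

(** Uncrossing rests on submodularity. The connectivities of two opposite quadrants add up to at
    most those of the two partitions. A quadrant with two elements uses up its full share, so the
    opposite quadrant [R] gives a vertical 3-partition at [y] unless [y |: R] has rank at most 2.
    Minimality excludes the former, and this is where lines come from: a side of a partition at [y]
    with all but one element on a line through [y] is a cocircuit. Once two points of [L] have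
    partners, their two cocircuits control the line. They produce the partner of a third point, or
    show that [si (M / e)] is 3-connected, and they rule out every other spore. Three partnered
    points are needed for [M / L], where two of the partners must avoid a common side of a
    separation. The bound |E(N)| >= 4 does more than exclude small cases: after contracting a point
    [f] of [L], it forces the side [(L - f) + v] to carry at most one element of [N], which leaves
    room to contract the rest of [L]. *)

Lemma mem_subset_imp (T : finType) (A B : {set T}) (u : T) :
  A \subset B -> (u \in A) ==> (u \in B).
Proof. by move=> /subsetP sAB; apply/implyP/sAB. Qed.

Lemma mem_eq_set (T : finType) (A B : {set T}) (u : T) :
  A = B -> (u \in A) == (u \in B).
Proof. by move=> ->. Qed.

Lemma mem_disjoint (T : finType) (A B : {set T}) (u : T) :
  [disjoint A & B] -> ~~ ((u \in A) && (u \in B)).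
Proof. by move=> dAB; apply/negP=> /andP[/(disjointFr dAB) ->]. Qed.

Ltac set_facts u :=
  repeat match goal with
  | H : is_true (_ \subset _) |- _ => move: (mem_subset_imp u H); clear H
  | H : is_true [disjoint _ & _] |- _ => move: (mem_disjoint u H); clear H
  | H : @eq _ ?A ?B |- _ => move: (@mem_eq_set _ A B u H); clear H
  | H : is_true (_ \in _) |- _ => move: H
  | H : is_true (~~ (_ \in _)) |- _ => move: H
  | H : is_true (~~ (_ == _)) |- _ => move: H
  | H : forall x, is_true _ |- _ => move: (H u); clear H
  | H : forall x, @eq bool _ _ |- _ => move: (H u); clear H
  end.

Ltac set_cases :=
  rewrite ?inE /= ?eqxx ?implybE /=;
  repeat match goal with
  | |- context [?x == ?y] =>
      lazymatch type of x with bool => fail | _ =>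
      let e := fresh in case: (eqVneq x y) => e;
      [repeat match goal with H : is_true (~~ (_ == _)) |- _ => move: H end;
       rewrite {}e | idtac] end; rewrite ?eqxx //=
  | |- context [?x \in ?A] => case: (x \in A); rewrite //=
  end.

(* Decides set identities pointwise at [u], by cases on all memberships and
   equalities, using the facts about sets that are in the context. *)
Ltac set_at u := solve [clear; set_cases | set_facts u; set_cases].

Ltac set_dec :=
  let u := fresh "u" in
  lazymatch goal with
  | |- is_true (_ \subset _) => apply/subsetP=> u; set_at u
  | |- is_true [disjoint _ & _] =>
      rewrite -setI_eq0; apply/eqP/setP=> u; set_at u
  | |- @eq (set_of _) _ _ => apply/setP=> u; set_at u
  | |- is_true (?a \in _) => set_at a
  | |- is_true (~~ (?a \in _)) => set_at a
  | |- is_true (~~ (?a == _)) => set_at a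
  end.

(* The preprocessing of [lia] is very slow on boolean set facts. *)
Ltac rank_lia :=
  repeat match goal with
  | H : is_true (_ \subset _) |- _ => clear H
  | H : is_true [disjoint _ & _] |- _ => clear H
  | H : @eq (set_of _) _ _ |- _ => clear H
  | H : is_true (_ \in _) |- _ => clear H
  | H : is_true (~~ (_ \in _)) |- _ => clear H
  | H : is_true (~~ (_ == _)) |- _ => clear H
  | H : forall x : ?A, _ |- _ =>
      lazymatch type of A with Prop => fail | _ => clear H end
  end; lia.

(** * Spans, and cocircuits in terms of rank *)

Section Rank.
Variables (T : finType) (M : matroid T).
Local Notation E := (ground M).
Local Notation r := (rk M).
Implicit Types (X Y Z A B D S : {set T}) (x y z a b : T).

Lemma rk_sub_submod A B S Z :
  S \subset A :|: B -> Z \subset A -> Z \subset B -> r S + r Z <= r A + r B.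
Proof.
move=> sS sA sB; apply: leq_trans (rk_submod M A B); apply: leq_add.
  exact: rk_mono.
by apply: rk_mono; rewrite subsetI sA.
Qed.

Lemma rk_subU A B S : S \subset A :|: B -> r S <= r A + r B.
Proof. by move=> sS; have := rk_sub_submod sS (sub0set A) (sub0set B); lia. Qed.

Lemma rkU1 x A : r (x |: A) <= (r A).+1.
Proof.
have := rk_subU (subxx (x |: A)); have := rk_le_card M [set x].
by rewrite cards1; lia.
Qed.

Lemma rk_span_mono x A B : A \subset B -> r (x |: A) = r A -> r (x |: B) = r B.
Proof.
move=> sAB eqr; apply/eqP; rewrite eqn_leq [r B <= _]rk_mono ?subsetUr // andbT.
have : r (x |: B) + r A <= r (x |: A) + r B.
  by apply: rk_sub_submod; set_dec.
by rewrite eqr; lia.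
Qed.

Lemma rk_span_set A S B : A \subset B -> B \subset S :|: A ->
  (forall x, x \in S -> r (x |: A) = r A) -> r B = r A.
Proof.
move=> sAB sBS spanS; apply/eqP; rewrite eqn_leq [r A <= _]rk_mono // andbT.
apply: leq_trans (rk_mono M sBS) _.
have [n] := ubnP #|S|; elim: n S {sBS} spanS => // n IH S spanS leS.
have [-> | [x Sx]] := set_0Vmem S; first by rewrite set0U.
rewrite -(setD1K Sx); have eqS : r (S :\ x :|: A) = r A.
  apply/eqP; rewrite eqn_leq [r A <= _]rk_mono ?subsetUr // IH // => [y|].
    by rewrite !inE => /andP[_ /spanS].
  by rewrite (cardsD1 x) Sx in leS.
by rewrite -setUA (rk_span_mono _ (spanS x Sx)) ?eqS ?subsetUr.
Qed.

Lemma rk_span_trans x A S : (forall y, y \in S -> r (y |: A) = r A) ->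
  r (x |: S) = r S -> r (x |: A) = r A.
Proof.
move=> spanS spanx.
have eqSA : r (S :|: A) = r A by apply: (rk_span_set (S := S)) => //; set_dec.
have := rk_span_mono (subsetUl S A) spanx.
have sA : r (x |: A) <= r (x |: (S :|: A)) by apply: rk_mono; set_dec.
have := rk_mono M (subsetUr [set x] A); lia.
Qed.

Lemma rk_mem x A : x \in A -> r (x |: A) = r A.
Proof. by move=> xA; congr (r _); apply/setUidPr; rewrite sub1set. Qed.

(** The complement of a hyperplane, which is what a cocircuit is. After [cocircuitP] the dual rank
    function is not met again. *)
Definition cocirc D := [/\ D \subset E, (r (E :\: D)).+1 = r E
  & forall u, u \in D -> r (u |: (E :\: D)) = r E].

Lemma cocircuitP D : cocircuit M D <-> cocirc D.
Proof.
have depE B : dependent (dual M) B = (B \subset E) && (r (E :\: B) < r E).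
  rewrite /dependent /=; case sBE: (B \subset E) => //=.
  rewrite (setIidPl sBE).
  have := @rk_subU B (E :\: B) E.
  have := rk_le_card M B; case: (set_0Vmem B) => [-> | [b Bb]].
    by rewrite setD0 cards0; lia.
  have B_gt0 : 0 < #|B| by apply/card_gt0P; exists b.
  by move=> ? /(_ ltac:(set_dec)); lia.
split.
  case/minsetP; rewrite depE => /andP[sDE ltD] minD.
  have spanD u : u \in D -> r (u |: (E :\: D)) = r E.
    move=> Du; have [depDu | Ndep] := boolP (dependent (dual M) (D :\ u)).
      have eqD := minD _ depDu (subsetDl _ _).
      by have := Du; rewrite -{1}eqD !inE eqxx.
    have -> : u |: (E :\: D) = E :\: (D :\ u).
      have uE := subsetP sDE u Du; set_dec.
    apply/eqP; rewrite eqn_leq rk_mono ?subsetDl //=.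
    move: Ndep; rewrite depE negb_and -leqNgt => /orP[/negP[]|//].
    exact: subset_trans (subsetDl _ _) sDE.
  split=> //; have [D0 | [u Du]] := set_0Vmem D.
    by move: ltD; rewrite D0 setD0 ltnn.
  by have := spanD u Du; have := rkU1 u (E :\: D); lia.
case=> sDE hypD spanD; apply/minsetP; split.
  by rewrite depE sDE -hypD ltnSn.
move=> B; rewrite depE => /andP[sBE ltB] sBD; apply/eqP; rewrite eqEsubset sBD.
apply/subsetP=> u Du; apply: contraLR ltB => Bu; rewrite -leqNgt -(spanD u Du).
by apply: rk_mono; have uE := subsetP sDE u Du; set_dec.
Qed.

(** The complement of [D] is closed, so a set that avoids [D] spans no element of [D]. Most rank
    increases below come from here. *)
Lemma cocirc_span D u S : cocirc D -> u \in D -> S \subset E ->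
  [disjoint S & D] -> r (u |: S) = (r S).+1.
Proof.
move=> [sDE hypD spanD] Du sSE dSD; apply/eqP; rewrite eqn_leq rkU1 /= ltnNge.
apply/negP=> leS; have eqS : r (u |: S) = r S.
  by have := rk_mono M (subsetUr [set u] S); lia.
have sS : S \subset E :\: D by set_dec.
by have := rk_span_mono sS eqS; rewrite spanD // -hypD; lia.
Qed.

End Rank.

(** * Points, lines and small sets in a 3-connected matroid *)

Section ThreeConnected.
Variables (T : finType) (M : matroid T).
Local Notation E := (ground M).
Local Notation r := (rk M).
Hypotheses (hM : n_connected 3 M) (hE : 4 <= #|E|).
Implicit Types (X Y Z A B S L D : {set T}) (x y z a b p q u v : T).

(** Additive form of the absence of k-separations. Subadditivity of the rank shows that the
    subtraction in [connectivity] does not truncate. *)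
Lemma connectivity_ge k X Y : 0 < k < 3 -> X \subset E -> Y \subset E ->
  [disjoint X & Y] -> E \subset X :|: Y -> k <= #|X| -> k <= #|Y| ->
  r E + k <= r X + r Y.
Proof.
move=> hk sX sY dXY sE cX cY.
have eqY : E :\: X = Y by set_dec.
have := hM X hk; rewrite /separation sX eqY cX cY /connectivity eqY /= !andbT.
have := rk_subU M sE; lia.
Qed.

(** With k = |X|, 3-connectivity gives r E + k <= r X + r (E - X), and r X <= k. The bound |E| >= 4
    leaves at least k elements outside [X]. *)
Lemma rk_compl_small X : X \subset E -> #|X| <= 2 -> r (E :\: X) = r E.
Proof.
move=> sX cX; apply/eqP; rewrite eqn_leq rk_mono ?subsetDl //=.
have [-> | [x Xx]] := set_0Vmem X; first by rewrite setD0.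
have X_gt0 : 0 < #|X| by apply/card_gt0P; exists x.
have cE : #|E :\: X| = #|E| - #|X| by rewrite cardsD (setIidPr sX).
have := @connectivity_ge #|X| X (E :\: X).
have -> : 0 < #|X| < 3 by rewrite X_gt0.
move=> /(_ isT sX (subsetDl _ _) ltac:(set_dec) ltac:(set_dec) (leqnn _)).
have := rk_le_card M X; lia.
Qed.

Lemma rk1 x : x \in E -> r [set x] = 1.
Proof.
move=> xE; have sx : [set x] \subset E by rewrite sub1set.
have := @connectivity_ge 1 [set x] (E :\ x) isT sx (subsetDl _ _).
move=> /(_ ltac:(set_dec) ltac:(set_dec)); rewrite cards1.
have := rk_compl_small sx; rewrite cards1 => -> //.
have := rk_le_card M [set x]; rewrite cards1.
have := cardsD1 x E; rewrite xE; lia.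
Qed.

Lemma rk2 x y : x \in E -> y \in E -> x != y -> r [set x; y] = 2.
Proof.
move=> xE yE xy; have sx : [set x; y] \subset E by rewrite subUset !sub1set xE.
have cxy : #|[set x; y]| = 2 by rewrite cards2 xy.
have := @connectivity_ge 2 [set x; y] (E :\: [set x; y]) isT sx (subsetDl _ _).
move=> /(_ ltac:(set_dec) ltac:(set_dec)).
rewrite rk_compl_small ?cxy // cardsD (setIidPr sx) cxy.
have := rk_le_card M [set x; y]; rewrite cxy; lia.
Qed.

(** Two distinct points have rank 2 and hence span the line they lie on. *)
Lemma line_span L A p q u : L \subset E -> r L <= 2 -> p \in L -> q \in L ->
  p != q -> r (p |: A) = r A -> r (q |: A) = r A -> u \in L ->
  r (u |: A) = r A.
Proof.
move=> sL rL Lp Lq pq spanp spanq Lu.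
apply: (@rk_span_trans _ M u A [set p; q]).
  by move=> y; rewrite !inE => /orP[] /eqP ->.
have r2 : r [set p; q] = 2 by rewrite rk2 // (subsetP sL).
have := rk_mono M (subsetUr [set u] [set p; q]).
have := rk_mono M (_ : u |: [set p; q] \subset L).
by move=> /(_ ltac:(set_dec)); lia.
Qed.

(** A hyperplane through two points of a line contains the line. So a cocircuit that meets a line
    misses at most one of its points. *)
Lemma line_cocirc L D p q u : cocirc M D -> L \subset E -> r L <= 2 ->
  p \in L -> q \in L -> p != q -> u \in L -> u \in D -> (p \in D) || (q \in D).
Proof.
move=> cD sL rL Lp Lq pq Lu Du; apply/norP=> -[pD qD].
have sS : [set p; q] \subset E by set_dec.
have := @cocirc_span _ M D u [set p; q] cD Du sS ltac:(set_dec).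
have pS : p \in [set p; q] by rewrite !inE eqxx.
have qS : q \in [set p; q] by rewrite !inE eqxx orbT.
by rewrite (line_span sL rL Lp Lq pq (rk_mem M pS) (rk_mem M qS) Lu); rank_lia.
Qed.

Lemma cocirc_card D : cocirc M D -> 3 <= #|D|.
Proof.
case=> sD hypD _; rewrite leqNgt; apply/negP=> lt; have := rk_compl_small sD.
lia.
Qed.

End ThreeConnected.

Lemma exists_other2 (T : finType) (L : {set T}) (a b : T) : 3 <= #|L| ->
  exists p, [/\ p \in L, p != a & p != b].
Proof.
move=> cL; have : 0 < #|L :\: [set a; b]|.
  have := cardsID [set a; b] L; have := subset_leq_card (subsetIr L [set a; b]).
  by rewrite cards2; case: (a != b); lia.
case/card_gt0P=> p; rewrite !inE negb_or => /andP[/andP[pa pb] Lp].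
by exists p.
Qed.

(** * Vertical 3-partitions and spore lines *)

Section Vertical.
Variables (T : finType) (M : matroid T).
Local Notation E := (ground M).
Local Notation r := (rk M).
Implicit Types (X Y Z A B S L D P R : {set T}) (x y z a b p q u v g : T).

(* The obstructions to [si (M / x)] being 3-connected. *)
Record vertical3 X x Y : Prop := Vertical3 {
  v3_part : forall u, (u \in E) = [|| u == x, u \in X | u \in Y];
  v3_dis : [disjoint X & Y];
  v3_notX : x \notin X;
  v3_notY : x \notin Y;
  v3_spanX : r (x |: X) = r X;
  v3_spanY : r (x |: Y) = r Y;
  v3_rk : r X + r Y = r E + 2;
  v3_rkX : 3 <= r X;
  v3_rkY : 3 <= r Y }.

(* [L] is a line of [M] and [(L - x, v)] is a spore of [M / x]. *)
Record spore_line L x v : Prop := SporeLine {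
  sline_sub : L \subset E;
  sline_rk : r L <= 2;
  sline_flat : forall u, u \in E -> r (u |: L) = r L -> u \in L;
  sline_card : 3 <= #|L|;
  sline_in : x \in L;
  sline_out : v \notin L;
  sline_coc : cocirc M (v |: (L :\ x)) }.

Lemma vertical3C X x Y : vertical3 X x Y -> vertical3 Y x X.
Proof.
move=> [ptn dis xX xY sX sY rXY rX rY]; split; rewrite // 1?addnC //.
  by move=> u; rewrite ptn [X in _ || X]orbC.
by rewrite disjoint_sym.
Qed.

(** [S] lies in cl(X) and in cl(Y). These sets have ranks with sum r E + 2 and together span [E], so
    submodularity leaves rank at most 2 for what they share. *)
Lemma vertical3_guts X x Y S : vertical3 X x Y -> (forall u, u \in S ->
  r (u |: X) = r X) ->
  (forall u, u \in S -> r (u |: Y) = r Y) -> r S <= 2.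
Proof.
move=> [ptn dis xX xY sX sY rXY rX rY] SX SY.
have eX : r (S :|: X) = r X by apply: (rk_span_set _ _ SX) => //; set_dec.
have eY : r (S :|: Y) = r Y by apply: (rk_span_set _ _ SY) => //; set_dec.
have := @rk_sub_submod _ M (S :|: X) (S :|: Y) (X :|: Y) S.
move=> /(_ ltac:(set_dec) ltac:(set_dec) ltac:(set_dec)).
have : r (x |: (X :|: Y)) = r (X :|: Y).
  by apply: rk_span_mono sX; apply: subsetUl.
have -> : x |: (X :|: Y) = E by set_dec.
rank_lia.
Qed.

Hypotheses (hM : n_connected 3 M) (hE : 4 <= #|E|).

(** The form suited to uncrossing: [B] may overlap [A], and a rank bound on the complement of [A]
    replaces a count of its elements. *)
Lemma conn_le A B : A \subset E -> E \subset A :|: B -> 2 <= #|A| ->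
  3 <= r (E :\: A) -> r E + 2 <= r A + r B.
Proof.
move=> sA sE cA rA; have sub : E :\: A \subset B by set_dec.
have := rk_mono M sub; have cB := leq_trans rA (rk_le_card M _).
have := @connectivity_ge _ M hM hE 2 A (E :\: A) isT sA (subsetDl _ _).
by move=> /(_ ltac:(set_dec) ltac:(set_dec) cA (ltnW cB)); rank_lia.
Qed.

(** The side [z |: P] has rank exactly 3, so [Y] has rank r E - 1, and [y |: Y] is a hyperplane with
    complement [z |: P]. No point of [P] is in cl(Y), since with [y] it would bring in the whole
    line. For the same reason no point of [Y] lies on the line. *)
Lemma vertical3_spore_line P z y Y : vertical3 (z |: P) y Y -> z \notin P ->
  r (y |: P) <= 2 ->
  spore_line (y |: P) y z.
Proof.
move=> [ptn dis yX yY sX sY rXY rX rY] zP rP.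
have sP : P \subset y |: P by apply: subsetUr.
have := rk_mono M sP; have := rkU1 M z P => leP rP2.
have rPe : r P = 2 by rank_lia.
have sYE : Y \subset E by set_dec.
have sPE : P \subset E by set_dec.
have spanz : r (z |: Y) = r E.
  have : r (z |: Y) <> r Y.
    move=> spanz; have e : r ([set y; z] :|: Y) = r Y.
      apply: (rk_span_set (S := [set y; z])) => //; first by set_dec.
      by move=> u; rewrite !inE => /orP[]/eqP->.
    have := @conn_le P ([set y; z] :|: Y) sPE ltac:(set_dec).
    have sYP : Y \subset E :\: P by set_dec.
    have := rk_mono M sYP; have := rk_le_card M P; rank_lia.
  have := rkU1 M z Y; have := rk_mono M (subsetUr [set z] Y).
  have := @rk_mono _ M (z |: Y) E ltac:(set_dec); rank_lia.
have spanp p : p \in P -> r (p |: Y) = r E.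
  move=> Pp; have : r (p |: Y) <> r Y.
    move=> spanp; have yp : y != p by apply: contraNneq yX => ->; set_at p.
    have e : r ((y |: P) :|: Y) = r Y.
      apply: (rk_span_set (S := y |: P)) => //; first by set_dec.
      move=> u; apply: (@line_span _ M hM hE (y |: P) Y y p) => //; set_dec.
    have zE : [set z] \subset E by set_dec.
    have := rk_compl_small hM hE zE; rewrite cards1 => /(_ isT).
    have := @rk_mono _ M (E :\ z) ((y |: P) :|: Y) ltac:(set_dec); rank_lia.
  have := rkU1 M p Y; have := rk_mono M (subsetUr [set p] Y).
  have := @rk_mono _ M (p |: Y) E ltac:(set_dec); rank_lia.
have P_gt0 : 0 < #|P| by have := rk_le_card M P; rank_lia.
have [p0 Pp0] := card_gt0P P_gt0.
have eD : z |: ((y |: P) :\ y) = z |: P by set_dec.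
have eED : E :\: (z |: P) = y |: Y by set_dec.
split=> //.
- by set_dec.
- move=> u uE spanu; apply/negP=> /negP uL.
  have uz : u != z.
    apply/eqP=> eu; move: spanu; rewrite eu.
    have := @rk_mono _ M (z |: P) (z |: (y |: P)) ltac:(set_dec); rank_lia.
  have uY : u \in Y by set_at u.
  have yu : y != u by apply: contraNneq yY => ->.
  have := spanp _ Pp0.
  rewrite (@line_span _ M hM hE (u |: (y |: P)) Y y u) // ?(rk_mem M uY) //;
    try set_dec.
    by rank_lia.
  by rewrite spanu.
- have yP : y \notin P by set_at y.
  by rewrite cardsU1 yP; have := rk_le_card M P; rank_lia.
- set_dec.
- set_dec.
- rewrite eD; split; first by set_dec.
    by rewrite eED sY; rank_lia.
  move=> u; rewrite eED => Du; apply/eqP; rewrite eqn_leq rk_mono /=; last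
    by set_dec.
  have : r (u |: Y) = r E by move: Du; rewrite inE => /orP[/set1P->|/spanp].
  by move=> <-; apply: rk_mono; set_dec.
Qed.

Lemma sline_rk2 L x v : spore_line L x v -> r L = 2.
Proof.
move=> [sL rL _ cL Lx _ _]; have [p [Lp px _]] := exists_other2 x x cL.
have pxE : r [set p; x] = 2 by rewrite (rk2 hM hE) // (subsetP sL).
have := @rk_mono _ M [set p; x] L ltac:(set_dec); rank_lia.
Qed.

Lemma sline_out_rk L x v u : spore_line L x v -> u \in E -> u \notin L ->
  r (u |: L) = 3.
Proof.
move=> dL uE uL; have := sline_rk2 dL; have := rkU1 M u L.
have := rk_mono M (subsetUr [set u] L).
have : r (u |: L) <> r L by move=> /(sline_flat dL uE); apply/negP.
rank_lia.
Qed.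

Lemma sline_outE L x v : spore_line L x v -> v \in E.
Proof. by case=> _ _ _ _ _ _ [sD _ _]; set_dec. Qed.

Lemma sline_cocE L x v u : spore_line L x v -> u \in L -> u != x ->
  u \in v |: (L :\ x).
Proof. by move=> dL uL ux; rewrite !inE ux uL orbT. Qed.

(* So [si (M / v)] is 3-connected. *)
Lemma sline_not_vertical3 L x v Y1 Y2 : spore_line L x v -> ~ vertical3 Y1 v Y2.
Proof.
move=> dL; have rL := sline_rk2 dL; have vE := sline_outE dL.
have rvL := sline_out_rk dL vE (sline_out dL).
case: (dL) => sL _ _ cL Lx vL cD.
(* As [v] is not on [L], one side contains two of the at least three points of [L], and so spans
   [L]. *)
suff claim Z1 Z2 : vertical3 Z1 v Z2 -> 2 <= #|L :&: Z1| -> False.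
  move=> h; have sLU : L = (L :&: Y1) :|: (L :&: Y2).
    by case: h => ptn _ _ _ _ _ _ _ _; set_dec.
  have := cardsUI (L :&: Y1) (L :&: Y2); rewrite -sLU => cU.
  have [c1 | c1] := leqP 2 #|L :&: Y1|; first exact: claim h c1.
  apply: claim (vertical3C h) _.
  have -> : #|L :&: Y2| = #|L| - #|L :&: Y1| + #|(L :&: Y1) :&: (L :&: Y2)|.
    by have := subset_leq_card (subsetIl L Y1); rank_lia.
  by rank_lia.
move=> h c1; case: (h) => ptn dis vZ1 vZ2 s1 s2 r12 r1 r2.
have [p [q [/setIP[Lp Z1p] /setIP[Lq Z1q] pq]]] := card_gt1P c1.
have span1 u : u \in L -> r (u |: Z1) = r Z1.
  by apply: (line_span hM hE sL _ Lp Lq pq); rewrite ?rL // rk_mem.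
(* [Z2 - L] avoids the cocircuit and does not span [v], whereas [Z2] does. Moving [L] and [v] to the
   other side thus lowers the connectivity too far. *)
have [c2 | c2] := leqP 2 #|Z2 :\: L|.
  have sZ : Z2 :\: L \subset E by set_dec.
  have := cocirc_span (S := Z2 :\: L) cD (setU11 _ _) sZ ltac:(set_dec).
  have := @rk_mono _ M (v |: (Z2 :\: L)) (v |: Z2) ltac:(set_dec).
  have e1 : r ((v |: L) :|: Z1) = r Z1.
    apply: (rk_span_set (S := v |: L)) => //; first by set_dec.
    by move=> u; rewrite !inE => /orP[/eqP->|/span1].
  have := @conn_le (Z2 :\: L) ((v |: L) :|: Z1) sZ ltac:(set_dec) c2.
  have := @rk_mono _ M Z1 (E :\: (Z2 :\: L)) ltac:(set_dec); rank_lia.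
have [c3 | c3] := leqP 2 #|L :&: Z2|; last first.
  by have := rk_le_card M Z2; have := cardsID L Z2; rewrite setIC; rank_lia.
have [p' [q' [/setIP[Lp' Zp'] /setIP[Lq' Zq'] pq']]] := card_gt1P c3.
have span2 u : u \in L -> r (u |: Z2) = r Z2.
  by apply: (line_span hM hE sL _ Lp' Lq' pq'); rewrite ?rL // rk_mem.
(* Now both sides contain two points of [L], and [v |: L] falls into the guts. *)
suff : r (v |: L) <= 2 by rewrite rvL.
apply: (vertical3_guts h) => u; rewrite !inE => /orP[/eqP->|Lu] //;
  first exact: span1.
exact: span2.
Qed.

(** If [L] met both sides, the side with [v] would span [L], by [y] and one further point. The other
    side without [L] avoids a cocircuit through [y], so it loses rank when [L] is moved away,
    against 3-connectivity. *)
Lemma sline_vertical3_side L x v y Y1 Y2 p q : spore_line L x v -> y \in L ->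
  y != x ->
  vertical3 Y1 y Y2 -> p \in L -> p \in Y1 -> q \in L -> q \in Y2 -> False.
Proof.
move=> dL Ly yx; have rL := sline_rk2 dL; have vE := sline_outE dL.
case: (dL) => sL _ _ cL Lx vL cD.
suff claim Z1 Z2 p' q' : vertical3 Z1 y Z2 -> p' \in L -> p' \in Z1 ->
  q' \in L ->
    q' \in Z2 -> v \in Z1 -> False.
  move=> h Lp Y1p Lq Y2q; have vy : v != y by apply: contraNneq vL => ->.
  have := v3_part h v; rewrite vE (negPf vy) /= => /esym/orP[v1 | v2].
    exact: (claim _ _ p q h).
  exact: (claim _ _ q p (vertical3C h)).
move=> h Lp Z1p Lq Z2q Z1v; case: (h) => ptn dis yZ1 yZ2 s1 s2 r12 r1 r2.
have yp : y != p' by apply: contraNneq yZ1 => ->.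
have span1 u : u \in L -> r (u |: Z1) = r Z1.
  by apply: (line_span hM hE sL _ Ly Lp yp); rewrite ?rL // rk_mem.
have sZ : Z2 :\: L \subset E by set_dec.
have yD := sline_cocE dL Ly yx.
have rZ : r (y |: (Z2 :\: L)) = (r (Z2 :\: L)).+1.
  by apply: cocirc_span cD yD sZ _; set_dec.
have := @rk_mono _ M (y |: (Z2 :\: L)) (y |: Z2) ltac:(set_dec).
have e1 : r (L :|: Z1) = r Z1.
  by apply: (rk_span_set (S := L)) => //; set_dec.
have := @rk_mono _ M Z1 (E :\: (Z2 :\: L)) ltac:(set_dec).
have [c2 | c2] := leqP 2 #|Z2 :\: L|.
  have := @conn_le (Z2 :\: L) (L :|: Z1) sZ ltac:(set_dec) c2.
  rank_lia.
have := rk_compl_small hM hE sZ (ltnW c2).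
have := @rk_mono _ M (E :\: (Z2 :\: L)) (L :|: Z1) ltac:(set_dec).
have := @rk_subU _ M (Z2 :\: L) L Z2 ltac:(set_dec).
have := rk_le_card M (Z2 :\: L); rank_lia.
Qed.

(** With [v] outside [Y2], the set [Y2] would avoid the cocircuit [v |: (L :\ x)] and could not span
    its element [y]. *)
Lemma sline_vertical3_split L x v y Y1 Y2 p : spore_line L x v -> y \in L ->
  y != x ->
  vertical3 Y1 y Y2 -> p \in L -> p \in Y1 -> L :\ y \subset Y1 /\ v \in Y2.
Proof.
move=> dL Ly yx h Lp Y1p; have side := sline_vertical3_side dL Ly yx h Lp Y1p.
case: (dL) => sL _ _ cL Lx vL cD; case: (h) => ptn dis yY1 yY2 s1 s2 _ _ _.
have L2 u : u \in L -> (u \in Y2) = false.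
  by move=> Lu; apply/negP=> /(side u Lu).
split.
  apply/subsetP=> u /setD1P[uy Lu].
  have := ptn u; rewrite (subsetP sL) // (negPf uy) L2 // orbF /=.
  by move=> <-.
apply: contraT => vY2; have sY2 : Y2 \subset E by set_dec.
have dLY : [disjoint Y2 & v |: (L :\ x)].
  rewrite disjoint_sym disjoints_subset; apply/subsetP=> u.
  rewrite !inE => /orP[/eqP->//|/andP[_ /L2->]//].
have := cocirc_span cD (sline_cocE dL Ly yx) sY2 dLY; rank_lia.
Qed.

(** [Z2] spans [g], so adding the single point [p] makes it span [L]. Hence moving [L] across raises
    the rank of that side by at most one, and 3-connectivity bounds the loss on the other. *)
Lemma vertical3_line_rk L g Z1 Z2 p : vertical3 Z1 g Z2 -> L \subset E ->
  r L <= 2 ->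
  g \in L -> p \in L -> p != g -> L :\ g \subset Z1 -> 2 <= #|Z1 :\: L| ->
  r Z1 <= (r (Z1 :\: L)).+1.
Proof.
move=> h sL rL Lg Lp pg sL1 cA; case: (h) => ptn dis _ _ s1 s2 r12 r1 r2.
have spanL u : u \in L -> r (u |: (p |: Z2)) = r (p |: Z2).
  apply: (line_span hM hE sL rL Lp Lg pg); first by rewrite rk_mem // setU11.
  by apply: rk_span_mono s2; apply: subsetUr.
have e2 : r (L :|: (p |: Z2)) = r (p |: Z2).
  by apply: (rk_span_set (S := L)) => //; set_dec.
have sA : Z1 :\: L \subset E by set_dec.
have := @conn_le (Z1 :\: L) (L :|: (p |: Z2)) sA ltac:(set_dec) cA.
have := @rk_mono _ M Z2 (E :\: (Z1 :\: L)) ltac:(set_dec).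
have := rkU1 M p Z2; rank_lia.
Qed.

(** Moves the elements of [X] that lie in cl(Y) to the other side; the elements that remain are
    those for which goodness is known. *)
Lemma vertical3_close X x Y : vertical3 X x Y ->
  exists Z Y', [/\ vertical3 Z x Y', Z \subset X,
  forall u, u \in X -> r (u |: Y) != r Y -> u \in Z,
  forall u, u \in Z -> r (u |: Y) != r Y &
  forall u, u \in Z -> r (u |: Y') != r Y'].
Proof.
move=> h; have [ptn dis xX xY sX sY rXY rX rY] := h.
have [Z memZ] : exists Z, forall u,
    (u \in Z) = (u \in X) && (r (u |: Y) != r Y).
  exists [set u in X | r (u |: Y) != r Y]; move=> u; by rewrite inE.
have [C memC] : exists C : {set T}, forall u,
    (u \in C) = (u \in X) && (r (u |: Y) == r Y).
  exists [set u in X | r (u |: Y) == r Y]; move=> u; by rewrite inE.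
have [Y' eqY'] : exists Y', Y' = C :|: Y by exists (C :|: Y).
have ZC u : (u \in X) = (u \in Z) || (u \in C).
  by rewrite memZ memC; case: (u \in X) => //=; case: eqP.
have dZC u : ~~ ((u \in Z) && (u \in C)).
  by rewrite memZ memC; case: (u \in X) => //=; case: eqP.
have spanC u : u \in C -> r (u |: Y) = r Y by rewrite memC => /andP[_ /eqP].
have NZY u : u \in Z -> r (u |: Y) != r Y by rewrite memZ => /andP[].
have ZX u : u \in X -> r (u |: Y) != r Y -> u \in Z by rewrite memZ => ->.
clear memZ memC.
have eY : r Y' = r Y by apply: (rk_span_set (S := C)) => //; set_dec.
have exY : r (x |: Y') = r Y' by apply: rk_span_mono sY; set_dec.
have NZ u : u \in Z -> r (u |: Y') != r Y'.
  move=> /NZY; apply: contraNneq => spanu; apply/eqP.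
  apply: (@rk_span_trans _ _ _ _ Y') => // w.
  by rewrite eqY' inE => /orP[/spanC//|]; apply: rk_mem.
have sZE : Z \subset E by set_dec.
have hZ : 3 <= #|Z|.
  rewrite leqNgt; apply/negP=> cZ; have := rk_compl_small hM hE sZE cZ.
  have -> : E :\: Z = x |: Y' by set_dec.
  by rewrite exY eY; rank_lia.
exists Z, Y'; split=> //; last by set_dec.
have := @rk_mono _ M Y (E :\: Z) ltac:(set_dec).
have := @conn_le Z (x |: Y') sZE ltac:(set_dec) (ltnW hZ).
have := @rk_mono _ M (x |: Z) (x |: X) ltac:(set_dec).
have := rk_mono M (subsetUr [set x] Z) => *.
split; rewrite ?eY //; try rank_lia; try set_dec.
by move=> u; set_at u.
Qed.

(** Submodularity for [y0 |: S] and [y |: Y1], which meet in [y |: R], and for [W] and [Y2]: the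
    four ranks add up to 2 r E + 4. The quadrant [W :&: Y2] accounts for at least r E + 2, which
    leaves at most r E + 2 for [y |: R] and its complement. *)
Lemma vertical3_uncross S y0 W y Y1 Y2 R : vertical3 S y0 W ->
  vertical3 Y1 y Y2 -> y \in S ->
  R = (y0 |: S) :&: Y1 -> 2 <= #|W :&: Y2| -> 2 <= #|R| ->
  3 <= r (y |: R) -> exists Z, vertical3 R y Z.
Proof.
move=> hS hY Sy eqR cWY cR rR.
have [ptn dis y0S y0W sS sW rSW rS rW] := hS.
have [ptnY disY yY1 yY2 s1 s2 r12 r1 r2] := hY.
have [Z eqZ] : exists Z, Z = E :\: (y |: R) by exists (E :\: (y |: R)).
have sWY : W :&: Y2 \subset E by set_dec.
have sRE : R \subset E by set_dec.
have sY2 : Y2 \subset Z by set_dec.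
have sWS : W :&: Y2 \subset W by set_dec.
have := @rk_mono _ M (y0 |: S) (E :\: (W :&: Y2)) ltac:(set_dec).
have := @conn_le (W :&: Y2) (y0 |: S :|: Y1) sWY ltac:(set_dec) cWY.
have := @rk_sub_submod _ M (y0 |: S) (y |: Y1) (y0 |: S :|: Y1) (y |: R)
  ltac:(set_dec) ltac:(set_dec) ltac:(set_dec).
have := @rk_sub_submod _ M W Y2 Z (W :&: Y2)
  ltac:(set_dec) ltac:(set_dec) ltac:(set_dec).
have eyZ : r (y |: Z) = r Z by apply: rk_span_mono s2.
have := @conn_le R (y |: Z) sRE ltac:(set_dec) cR.
have := @rk_mono _ M Y2 (E :\: R) ltac:(set_dec).
have := rk_mono M sY2; have := rk_mono M (subsetUr [set y] R) => *.
exists Z; split=> //; try rank_lia; try set_dec.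
by move=> u; set_at u.
Qed.

End Vertical.

(** * Descent to a line whose points in the cocircuit all have partners *)

Section Descent.
Variables (T : finType) (M : matroid T).
Local Notation E := (ground M).
Local Notation r := (rk M).
Hypotheses (hM : n_connected 3 M) (hE : 4 <= #|E|).
Implicit Types (X Y Z A B S L D P Q R W V : {set T}).
Implicit Types (x y z a b p q u v g w : T).
Local Notation vertical3 := (vertical3 M).
Local Notation spore_line := (spore_line M).
Variables (C : {set T}) (good : T -> Prop).
Hypothesis cC : cocirc M C.
(* [good s] stands for: [M / s] has an [N]-minor.  The next two hypotheses hold
   when (i) and (ii) fail. *)
Hypothesis good_vertical3 : forall x, x \in C -> good x ->
  exists X Y, vertical3 X x Y /\ forall s, s \in X -> r (s |: Y) != r Y ->
    good s.
Hypothesis no_fan : forall L y v b v', spore_line L y v' -> L = [set y; v; b] ->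
  y \in C -> b \in C -> good v -> (forall Y1 Y2, ~ vertical3 Y1 v Y2) -> False.

(** The third condition is what [vertical3_close] achieves. It turns goodness outside cl(Y) into
    goodness of all of [X], so that any element of [X] in [C] can start a new partition. *)
Definition small_part X x Y := [/\ vertical3 X x Y, x \in C,
  forall u, u \in X -> r (u |: Y) != r Y & forall s, s \in x |: X -> good s].

(* For a vertical 3-partition [(X, x, Y)] this means [X = (L - x) + v] for a
   spore line [L]; see [spore_part_line]. *)
Definition spore_part X x := exists2 z, z \in X & r ((x |: X) :\ z) <= 2.

Lemma small_part_sub P y Z : vertical3 P y Z -> y \in C ->
  (forall s, s \in y |: P -> good s) -> exists P' Z', small_part P' y Z' /\ P'
    \subset P.
Proof.
move=> h Cy gP; have [P' [Z' [h' sP _ _ N]]] := vertical3_close hM hE h.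
exists P', Z'; split=> //; split=> // s; rewrite inE => /orP[/set1P->|sP'].
  by apply: gP; rewrite setU11.
by apply: gP; rewrite inE (subsetP sP) ?orbT.
Qed.

Lemma small_part_exists x : x \in C -> good x -> exists X Y, small_part X x Y.
Proof.
move=> Cx gx; have [X [Y [h gX]]] := good_vertical3 Cx gx.
have [Z [Y' [h' sZ _ NY N]]] := vertical3_close hM hE h.
exists Z, Y'; split=> // s; rewrite inE => /orP[/set1P->//|Zs].
by apply: gX (NY _ Zs); apply: (subsetP sZ).
Qed.

Lemma spore_part_line X x Y : vertical3 X x Y -> spore_part X x ->
  exists L v, spore_line L x v /\ X = v |: (L :\ x).
Proof.
move=> h [z Xz r2]; have [ptn dis xX xY sX sY rXY rX rY] := h.
have eX : z |: (X :\ z) = X by rewrite setD1K.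
have xz : x != z by apply: contraNneq xX => ->.
have eL : (x |: X) :\ z = x |: (X :\ z) by set_dec.
exists (x |: (X :\ z)), z; split.
  apply: (vertical3_spore_line hM hE (Y := Y)); rewrite ?eX -?eL //.
  by rewrite !inE eqxx.
by set_dec.
Qed.

Lemma line_eq L x v L' x' v' p q : spore_line L x v -> spore_line L' x' v' ->
  p \in L -> q \in L -> p \in L' -> q \in L' -> p != q -> L' = L.
Proof.
have sub L1 L2 x1 x2 v1 v2 : spore_line L1 x1 v1 -> spore_line L2 x2 v2 ->
  p \in L1 ->
    q \in L1 -> p \in L2 -> q \in L2 -> p != q -> L1 \subset L2.
  move=> d1 d2 p1 q1 p2 q2 pq; apply/subsetP=> u L1u.
  apply: (sline_flat d2); first exact: (subsetP (sline_sub d1)).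
  by apply: (line_span hM hE (sline_sub d1) (sline_rk d1) p1 q1 pq) => //;
    apply: rk_mem.
move=> dL dL' pL qL pL' qL' pq; apply/eqP; rewrite eqEsubset.
by rewrite (sub _ _ _ _ _ _ dL' dL) // (sub _ _ _ _ _ _ dL dL').
Qed.

(* If [L' <> L], then [L' = {y, v, b}] is the triangle of a four-element fan as
   in (ii), contradicting [no_fan]. *)
Lemma sline_fan L x v y L' v' : spore_line L x v -> y \in L -> y != x ->
  y \in C ->
  good v -> spore_line L' y v' -> L' = L.
Proof.
move=> dL Ly yx Cy gv dL'; apply: NNPP => neqL.
have cD := sline_coc dL; have yD := sline_cocE dL Ly yx.
have [sL' rL' _ cL' L'y _ cD'] := dL'.
(* Distinct lines share only [y], so besides [y] at most [v] is common to [L'] and the cocircuit at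
   [x]. As [L'] misses at most one point of that cocircuit, it has no room beyond [y], [v] and one
   more point. *)
have inter u : u \in L' -> u != y -> u \in v |: (L :\ x) -> u = v.
  move=> L'u uy; rewrite !inE => /orP[/eqP->//|/andP[_ Lu]].
  by case: neqL; apply: (line_eq dL dL' Lu Ly).
have two p q : p \in L' -> q \in L' -> p != q -> p != y -> q != y ->
    (p == v) || (q == v).
  move=> L'p L'q pq py qy.
  have := line_cocirc hM hE cD sL' rL' L'p L'q pq L'y yD.
  by case/orP=> /inter -> //; rewrite eqxx ?orbT.
have yv : y != v by apply: contraNneq (sline_out dL) => <-.
have L'v : v \in L'.
  have [p [L'p py _]] := exists_other2 y y cL';
    have [q [L'q qy qp]] := exists_other2 y p cL'.
  by rewrite eq_sym in qp; have /orP[] := two p q L'p L'q qp py qy => /eqP <-.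
have [b [L'b by_ bv]] := exists_other2 y v cL'.
have eL' : L' = [set y; v; b].
  apply/eqP; rewrite eqEsubset; apply/andP; split; last by set_dec.
  apply/subsetP=> u L'u; rewrite !inE; apply: contraT.
  rewrite !negb_or => /andP[/andP[uy uv] ub].
  by have := two u b L'u L'b ub uy by_; rewrite (negPf uv) (negPf bv).
have vC : v \notin C.
  apply/negP=> Cv; have [X [Y [h _]]] := good_vertical3 Cv gv.
  exact: (sline_not_vertical3 hM hE dL h).
have Cb : b \in C.
  have vb : v != b by rewrite eq_sym.
  have := line_cocirc hM hE cC sL' rL' L'v L'b vb L'y Cy.
  by rewrite (negPf vC).
apply: no_fan dL' eL' Cy Cb gv _ => Y1 Y2;
  exact: (sline_not_vertical3 hM hE dL).
Qed.

Lemma card1_of A : 0 < #|A| -> #|A| <= 1 -> exists c, A = [set c].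
Proof. by move=> c0 c1; apply/cards1P; rewrite eqn_leq c1. Qed.

Lemma rk_line_of_card A y : #|A| <= 1 -> r (y |: A) <= 2.
Proof. by move=> cA; have := rkU1 M y A; have := rk_le_card M A; lia. Qed.

(** * A spore part inside a minimal part that is not one *)

Section Minimal.
Variables (S : {set T}) (y0 : T) (W : {set T}).
Hypothesis hS : small_part S y0 W.
Hypothesis minS : forall S' y' W', small_part S' y' W' -> #|S'| < #|S| ->
  spore_part S' y'.

(** By minimality [X] is [(L - x) + v]. For another point [y] of [L] in [C], a partition at [y] is
    uncrossed with [(S, y0, W)]. Each vertical quadrant inside [S] is too small not to be a spore
    part, and [sline_fan] then makes its line equal to [L]. *)
Lemma inner_sline X x Z : small_part X x Z -> #|X| < #|S| ->
  x |: X \subset y0 |: S ->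
  exists2 L : {set T}, x \in L & forall y, y \in L -> y \in C ->
    exists v, spore_line L y v.
Proof.
move=> hX cX sXS; have [hXv Cx NX gX] := hX; have [hSv Cy0 NS gS] := hS.
have [L [v [dL eX]]] := spore_part_line hXv (minS hX cX).
exists L => [|y Ly Cy]; first exact: sline_in dL.
have [-> | yx] := eqVneq y x; first by exists v.
have [sL rL fL cL Lx vL cD] := dL.
have [ptn dis y0S y0W sS sW rSW rS rW] := hSv.
have gv : good v by apply: gX; set_dec.
have gy : good y by apply: gX; set_dec.
(* At [y0] the line would split off [v] into [W], although [v] is in [X] and so in [y0 |: S]. *)
have yy0 : y != y0.
  apply/eqP=> ey; have [] := sline_vertical3_split hM hE dL (y := y0) (p := x)
    _ _ hSv Lx.
  - by rewrite -ey.
  - by rewrite -ey.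
  - by rewrite ey in Ly yx; rewrite eq_sym in yx; set_dec.
  move=> _ Wv; have vy0 : v != y0 by rewrite -ey; apply: contraNneq vL => ->.
  by clear - eX sXS dis Wv vy0; move: (mem_eq_set v eX); rewrite !inE eqxx /=;
    set_at v.
have Sy : y \in S by set_dec.
have sub P Z' w : vertical3 P y Z' -> P \subset (y0 |: S) :\ y ->
  w \in y0 |: S ->
    w != y -> w \notin P -> exists v', spore_line L y v'.
  move=> hP sP Sw wy wP.
  have gP s : s \in y |: P -> good s by move=> Ps; apply: gS; set_dec.
  have [P' [Z'' [hP' sP']]] := small_part_sub hP Cy gP.
  have cP' : #|P'| < #|S|.
    have : P' \subset ((y0 |: S) :\ y) :\ w by clear - sP sP' wP; set_dec.
    move/subset_leq_card; have := cardsD1 w ((y0 |: S) :\ y).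
    have := cardsD1 y (y0 |: S); rewrite cardsU1 y0S !in_setD1 Sw wy.
    by rewrite in_setU1 Sy orbT; rank_lia.
  have [hP'v _ _ _] := hP'.
  have [L' [v' [dL' _]]] := spore_part_line hP'v (minS hP' cP').
  by exists v'; rewrite -(sline_fan dL Ly yx Cy gv dL').
have [Y1 [Y2 [hY Y1x]]] : exists Y1 Y2, vertical3 Y1 y Y2 /\ x \in Y1.
  have [Y1 [Y2 [hY _]]] := good_vertical3 Cy gy.
  have := v3_part hY x; rewrite (subsetP sL) // eq_sym (negPf yx) /=.
  move=> /esym/orP[? | ?]; first by exists Y1, Y2.
  by exists Y2, Y1; split=> //; apply: vertical3C.
have [sLY Y2v] := sline_vertical3_split hM hE dL Ly yx hY Lx Y1x.
have [ptnY disY yY1 yY2 s1 s2 r12 r1 r2] := hY.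
have [Q eQ] : exists Q, Q = (y0 |: S) :&: Y1 by exists ((y0 |: S) :&: Y1).
have [R eR] : exists R, R = (y0 |: S) :&: Y2 by exists ((y0 |: S) :&: Y2).
have sLQ : L :\ y \subset Q by clear - sLY eQ eX sXS; set_dec.
have Rv : v \in R by clear - eR Y2v eX sXS; set_dec.
have xy : x != y by rewrite eq_sym.
have vy : v != y by apply: contraNneq vL => ->.
have subQ Z' : vertical3 Q y Z' -> exists v', spore_line L y v'.
  move=> hQ; apply: (sub _ _ v hQ) => //; [| |]; clear - eQ eR Rv disY yY1;
    set_dec.
have subR Z' : vertical3 R y Z' -> exists v', spore_line L y v'.
  move=> hR; apply: (sub _ _ x hR) => //; clear - eR sXS disY yY2 Y1x; set_dec.
have cQ : 2 <= #|Q|.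
  by have := subset_leq_card sLQ; have := cardsD1 y L; rewrite Ly; rank_lia.
(* A side has rank at least 3, so it is not exhausted by a quadrant that lies on a line with [y]. *)
have rYle A B c : Y1 = B \/ Y2 = B -> B = A :|: c -> r (y |: A) <= 2 ->
  0 < #|c|.
  move=> eB eBA rA; rewrite lt0n; apply/negP=> /eqP/cards0_eq c0.
  rewrite c0 setU0 in eBA; rewrite -eBA in rA.
  have := rk_mono M (subsetUr [set y] B); case: eB rA => <- rA; rank_lia.
have eW : W = (W :&: Y1) :|: (W :&: Y2).
  by clear - ptn ptnY dis Sy; set_dec.
have cW := leq_trans rW (rk_le_card M W).
have cWW : #|W| <= #|W :&: Y1| + #|W :&: Y2|.
  by rewrite {1}eW cardsU leq_subr.
have [c2 | c2] := leqP 2 #|W :&: Y2|; last first.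
  have c1 : 2 <= #|W :&: Y1| by rank_lia.
  have eY2 : Y2 = R :|: (W :&: Y2) by clear - ptn ptnY eR yY2; set_dec.
  have cR : 2 <= #|R|.
    have := rk_le_card M Y2; have := cardsU R (W :&: Y2); rewrite -eY2.
    by rank_lia.
  have [rR | rR] := leqP 3 (r (y |: R)).
    have [Z' hR] := vertical3_uncross hM hE hSv (vertical3C hY) Sy eR c1 cR rR.
    exact: subR hR.
  have c0 := rYle _ _ _ (or_intror erefl) eY2 rR.
  have [c ec] := card1_of c0 c2.
  have e2 : c |: R = Y2 by rewrite -ec setUC -eY2.
  have dR := @vertical3_spore_line _ M hM hE R c y Y1; rewrite e2 in dR.
  have cR' : c \notin R.
    have : c \in W :&: Y2 by rewrite ec set11.
    by move=> Wc; clear - eR dis y0W Wc; set_dec.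
  have dR' := dR (vertical3C hY) cR' rR.
  by exists c; rewrite -(sline_fan dL Ly yx Cy gv dR').
have [rQ | rQ] := leqP 3 (r (y |: Q)).
  have [Z' hQ] := vertical3_uncross hM hE hSv hY Sy eQ c2 cQ rQ.
  exact: subQ hQ.
have sQE : y |: Q \subset E by clear - ptnY eQ; set_dec.
have eQL : y |: Q = L.
  have [p [Lp py _]] := exists_other2 y y cL.
  apply/eqP; rewrite eqEsubset; apply/andP; split; last by clear - sLQ; set_dec.
  apply/subsetP=> u Qu; apply: fL; first exact: (subsetP sQE).
  by apply: (line_span hM hE sQE rQ _ _ py) Qu; rewrite ?rk_mem //;
    clear - sLQ Lp py; set_dec.
have [c1 | c1] := leqP 2 #|W :&: Y1|; last first.
  have eY1 : Y1 = Q :|: (W :&: Y1) by clear - ptn ptnY eQ yY1; set_dec.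
  have c0 := rYle _ _ _ (or_introl erefl) eY1 rQ.
  have [c ec] := card1_of c0 c1.
  have e1 : c |: Q = Y1 by rewrite -ec setUC -eY1.
  have dQ := @vertical3_spore_line _ M hM hE Q c y Y2; rewrite e1 eQL in dQ.
  have cQ' : c \notin Q.
    have : c \in W :&: Y1 by rewrite ec set11.
    by move=> Wc; clear - eQ dis y0W Wc; set_dec.
  by exists c; apply: dQ hY cQ' _; rewrite -eQL.
have eS : y0 |: S = L :|: R by rewrite -eQL; clear - ptn ptnY Sy eQ eR; set_dec.
have cX' : #|X| = #|L|.
  by rewrite eX cardsU1 !inE negb_and vL orbT /= (cardsD1 x L) Lx.
have cS : #|y0 |: S| = #|S|.+1 by rewrite cardsU1 y0S.
have cR : 2 <= #|R|.
  by have := cardsU L R; rewrite -eS cS; rank_lia.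
have [rR | rR] := leqP 3 (r (y |: R)).
  have [Z' hR] := vertical3_uncross hM hE hSv (vertical3C hY) Sy eR c1 cR rR.
  exact: subR hR.
(* [y0 |: S] is now the union of two lines through [y], so r S <= 3 and r W >= r E - 1. As [Z]
   contains [W] and has rank at most r E - 1, an element of [S] in [x |: Z] would lie in cl(W),
   which [NS] forbids. Hence [S] avoids [x |: Z], which contradicts |X| < |S|. *)
exfalso.
have [ptnX disX xX xZ sX sZ rXZ rX rZ] := hXv.
have yE := subsetP sL _ Ly.
have := @rk_sub_submod _ M L (y |: R) (y0 |: S) [set y].
move=> /(_ ltac:(clear - eS; set_dec) ltac:(clear - Ly;
  set_dec) ltac:(set_dec)).
rewrite (rk1 hM hE yE) sS => rS3.
have sWZ : W \subset Z by clear - sXS ptn ptnX dis y0W; set_dec.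
have spanZ u : u \in x |: Z -> u \notin S.
  move=> Zu; apply/negP=> /NS; have := @rk_mono _ M (u |: W) (x |: Z)
    ltac:(clear - Zu sWZ; set_dec).
  by have := rk_mono M (subsetUr [set u] W) => ? ? /eqP; rank_lia.
have [u Su uX] : exists2 u, u \in y0 |: S & u \notin x |: X.
  apply/subsetPn; apply/negP=> /subset_leq_card; rewrite cS cardsU1 xX;
    rank_lia.
have xS : x \notin S by apply: spanZ; rewrite setU11.
have ex : x = y0 by apply/eqP; clear - sXS xS; move: (mem_subset_imp x sXS);
  rewrite !inE eqxx (negPf xS) orbF.
have : u \notin S by apply: spanZ; clear - Su uX ptn ptnX; set_dec.
by move: uX Su; rewrite !inE ex negb_or => /andP[/negPf-> _] /= ->.
Qed.
End Minimal.

(** * Parts that contain no smaller part *)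

Section Inner.
Variables (X1 : {set T}) (x : T) (X2 : {set T}).
Hypothesis hX : small_part X1 x X2.
Hypothesis Nspore : ~ spore_part X1 x.
Hypothesis minX : forall R y Z, small_part R y Z -> y |: R \proper x |: X1 ->
  False.

(** A vertical quadrant of [X1] would contradict minimality, so a quadrant lies on a line with [y]
    whenever the opposite one in [X2] has two elements. If the other quadrant of [X2] has at most
    one element, that line and this element form a spore line at [y]. If both have two, [X1]
    consists of two lines through [y], up to [x]. *)
Lemma inner_cases y : y \in X1 -> y \in C ->
  [\/ exists L z, [/\ spore_line L y z, x \in L, L \subset x |: X1 & z \in X2],
      exists L z, [/\ spore_line L y z, L \subset X1 & z \in X2] |
      exists W V w, [/\ X1 = y |: (W :|: V), [disjoint W & V] /\ w \in W,
        r (x |: (y |: W)) <= 2, r (y |: V) <= 2 & y \notin W :|: V /\ 2 <=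
          #|V|]].
Proof.
move=> X1y Cy; have [hv Cx NX gX] := hX.
have [ptn dis xX1 xX2 sX1 sX2 rX12 rX1 rX2] := hv.
have gy : good y by apply: gX; set_dec.
have yx : y != x by apply: contraNneq xX1 => <-.
have xE : x \in E by rewrite ptn eqxx.
have [Y1 [Y2 [hY Y1x]]] : exists Y1 Y2, vertical3 Y1 y Y2 /\ x \in Y1.
  have [Y1 [Y2 [hY _]]] := good_vertical3 Cy gy.
  have := v3_part hY x; rewrite xE eq_sym (negPf yx) /=.
  move=> /esym/orP[? | ?]; first by exists Y1, Y2.
  by exists Y2, Y1; split=> //; apply: vertical3C.
have [ptnY disY yY1 yY2 s1 s2 r12 r1 r2] := hY.
have sub P Z' w : vertical3 P y Z' -> P \subset (x |: X1) :\ y ->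
  w \in x |: X1 ->
    w != y -> w \notin P -> False.
  move=> hP sP Xw wy wP.
  have gP s : s \in y |: P -> good s.
    by move=> Ps; apply: gX; clear - Ps sP X1y; set_dec.
  have [P' [Z'' [hP' sP']]] := small_part_sub hP Cy gP.
  apply: (minX hP'); apply/properP; split; first by clear - sP sP' X1y; set_dec.
  by exists w => //; clear - sP' wP wy; set_dec.
have [Q eQ] : exists Q, Q = (x |: X1) :&: Y1 by exists ((x |: X1) :&: Y1).
have [R eR] : exists R, R = (x |: X1) :&: Y2 by exists ((x |: X1) :&: Y2).
(* Otherwise [Y2] lies in [x |: X2], and [y], which [Y2] spans, would be in cl(X2). *)
have [v Rv] : exists v, v \in R.
  apply/set0Pn/negP=> /eqP R0; have := NX _ X1y; apply/negP; rewrite negbK.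
  have sY2 : Y2 \subset x |: X2 by clear - ptn ptnY eR R0 yY2; set_dec.
  have := @rk_mono _ M (y |: X2) (y |: (x |: X2)) ltac:(set_dec).
  rewrite (rk_span_mono sY2 s2) sX2 eqn_leq => ->.
  exact/rk_mono/subsetUr.
have eX2 : X2 = (X2 :&: Y1) :|: (X2 :&: Y2) by clear - ptn ptnY dis X1y;
  set_dec.
have cX2 : 3 <= #|X2 :&: Y1| + #|X2 :&: Y2|.
  apply: leq_trans (leq_trans rX2 (rk_le_card M X2)) _.
  by rewrite {1}eX2 cardsU leq_subr.
have rR : 2 <= #|X2 :&: Y1| -> r (y |: R) <= 2.
  move=> c1; rewrite leqNgt; apply/negP=> rR.
  have [cR | cR] := leqP 2 #|R|; last by have := rk_line_of_card y cR; rank_lia.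
  have [Z' hR] := vertical3_uncross hM hE hv (vertical3C hY) X1y eR c1 cR rR.
  apply: (sub R Z' x) => //; clear - eR Y1x disY yY2 yx; set_dec.
have rQ : 2 <= #|X2 :&: Y2| -> r (y |: Q) <= 2.
  move=> c1; rewrite leqNgt; apply/negP=> rQ.
  have [cQ | cQ] := leqP 2 #|Q|; last by have := rk_line_of_card y cQ; rank_lia.
  have [Z' hQ] := vertical3_uncross hM hE hv hY X1y eQ c1 cQ rQ.
  by apply: (sub Q Z' v) => //; clear - eQ eR Rv disY yY2 yY1; set_dec.
have small A B B' : vertical3 B y B' -> r (y |: A) <= 2 ->
  B = A :|: (X2 :&: B) ->
    A \subset x |: X1 -> #|X2 :&: B| <= 1 ->
    exists2 z, z \in X2 & spore_line (y |: A) y z.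
  move=> hB rA eB sA c1; have [_ _ yB _ _ _ _ rB _] := hB.
  have c0 : 0 < #|X2 :&: B|.
    rewrite lt0n; apply/negP=> /eqP/cards0_eq c0.
    rewrite c0 setU0 in eB; rewrite -eB in rA.
    by have := rk_mono M (subsetUr [set y] B); rank_lia.
  have [c ec] := card1_of c0 c1.
  have cXB : c \in X2 :&: B by rewrite ec set11.
  have e1 : c |: A = B by rewrite -ec setUC -eB.
  exists c; first by case/setIP: cXB.
  apply: (@vertical3_spore_line _ M hM hE A c y B') => //; first by rewrite e1.
  by clear - sA cXB dis xX2; set_dec.
have [c2 | c2] := leqP 2 #|X2 :&: Y2|; last first.
  have c1 : 2 <= #|X2 :&: Y1| by rank_lia.
  have [||z X2z dz] := small R Y2 Y1 (vertical3C hY) (rR c1) _ _ c2.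
  - by clear - ptn ptnY eR yY2; set_dec.
  - by clear - eR; set_dec.
  by apply: Or32; exists (y |: R), z; split=> //; clear - eR X1y Y1x disY;
    set_dec.
have [c1 | c1] := leqP 2 #|X2 :&: Y1|; last first.
  have [||z X2z dz] := small Q Y1 Y2 hY (rQ c2) _ _ c1.
  - by clear - ptn ptnY eQ yY1; set_dec.
  - by clear - eQ; set_dec.
  by apply: Or31; exists (y |: Q), z; split=> //; clear - eQ X1y Y1x; set_dec.
have rQ2 := rQ c2; have rR2 := rR c1.
have [W eW] : exists W, W = Q :\ x by exists (Q :\ x).
have eQW : x |: (y |: W) = y |: Q by clear - eW eQ Y1x; set_dec.
have eX1 : X1 = y |: (W :|: R) by clear - eW eQ eR X1y Y1x ptn ptnY disY xX1;
  set_dec.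
have yWR : y \notin W :|: R by clear - eW eQ eR yY1 yY2; set_dec.
have disW : [disjoint W & R] by clear - eW eQ eR disY; set_dec.
have [W0 | [w Ww]] := set_0Vmem W.
  by move: eX1; rewrite W0 set0U => eX1; move: rX1; rewrite eX1; rank_lia.
apply: Or33; exists W, R, w; split=> //; first by rewrite eQW.
(* A single element in [R] would leave [X1] on a line with [x] but for that element, making it a
   spore part. *)
split=> //; rewrite ltnNge; apply/negP=> cR; apply: Nspore; exists v.
  by clear - eX1 Rv; set_dec.
have [|c ec] := card1_of _ cR; first by apply/card_gt0P; exists v.
have -> : (x |: X1) :\ v = y |: Q; last by [].
have vc : v = c by apply/set1P; rewrite -ec.
rewrite ec -vc in Rv eX1 eR disW yWR *.
by rewrite -eQW; clear - eX1 disW yWR xX1; set_dec.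
Qed.

(** [C] meets the line [y |: V] in some [v] other than [y], and [inner_cases] applies at [v]. In
    each outcome a line through [v] interacts with the two given lines so that one line spans [X1],
    or a line inside [X1] is forced to contain [x]. *)
Lemma no_two_lines y : y \in X1 -> y \in C ->
  ~ (exists W V w, [/\ X1 = y |: (W :|: V), [disjoint W & V] /\ w \in W,
        r (x |: (y |: W)) <= 2, r (y |: V) <= 2 & y \notin W :|: V /\ 2 <=
          #|V|]).
Proof.
move=> X1y Cy [W [V [w [eX1 [dWV Ww] rW rV [yWV cV]]]]].
have [hv Cx NX gX] := hX.
have [ptn dis xX1 xX2 sX1 sX2 rX12 rX1 rX2] := hv.
have s1E : x |: (y |: W) \subset E by clear - ptn eX1; set_dec.
have s2E : y |: V \subset E by clear - ptn eX1; set_dec.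
have xy : x != y by apply: contraNneq xX1 => ->.
have [l1 el1] : exists l1, l1 = x |: (y |: W) by exists (x |: (y |: W)).
have [l2 el2] : exists l2, l2 = y |: V by exists (y |: V).
rewrite -el1 in rW s1E; rewrite -el2 in rV s2E.
have sX1l : X1 \subset l1 :|: l2 by clear - eX1 el1 el2; set_dec.
have N1 : r (x |: l2) <> r l2.
  move=> spanx; have := rk_mono M sX1l.
  have -> : r (l1 :|: l2) = r l2.
    apply: (rk_span_set (S := l1)) => [||u]; [exact: subsetUr | exact: subxx |].
    by apply: (line_span hM hE s1E rW _ _ xy) => //;
      rewrite ?rk_mem // ?el1 ?el2 !inE ?eqxx ?orbT.
  by rank_lia.
have N2 v : v \in V -> r (v |: l1) <> r l1.
  move=> Vv spanv; have := rk_mono M sX1l.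
  have vy : v != y by clear - Vv yWV; set_dec.
  have -> : r (l1 :|: l2) = r l1.
    apply: (rk_span_set (S := l2)) => [||u]; [exact: subsetUl | by set_dec |].
    by apply: (line_span hM hE s2E rV _ _ vy) => //;
      rewrite ?rk_mem // ?el1 ?el2 !inE ?eqxx ?Vv ?orbT.
  by rank_lia.
have [v Vv Cv] : exists2 v, v \in V & v \in C.
  have [p [q [Vertical3 Vq pq]]] := card_gt1P cV.
  have := line_cocirc hM hE cC s2E rV (p := p) (q := q) (u := y).
  rewrite el2 !inE Vertical3 Vq eqxx !orbT => /(_ isT isT pq isT Cy) /orP[?|?].
    by exists p.
  by exists q.
have X1v : v \in X1 by clear - Vv eX1; set_dec.
have vy : v != y by clear - Vv yWV; set_dec.
have key L u : L \subset E -> r L <= 2 -> x \in L -> v \in L -> u \in L ->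
    u \in X1 -> u != v -> False.
  move=> sL rL Lx Lv Lu X1u uv; have : (u \in l2) || (u \in W).
    by move: X1u; rewrite eX1 el2 !inE => /or3P[] ->; rewrite ?orbT.
  case/orP=> [l2u | Wu].
    by apply: N1; apply: (line_span hM hE sL rL Lu Lv uv) => //;
      rewrite rk_mem // el2 !inE Vv orbT.
  have xu : x != u by apply: contraNneq xX1 => ->.
  by apply: (N2 v Vv); apply: (line_span hM hE sL rL Lx Lu xu) => //;
    rewrite rk_mem // el1 !inE ?eqxx ?Wu ?orbT.
case: (inner_cases X1v Cv).
- case=> [L [z [dL Lx sL X2z]]].
  have [u [Lu ux uv]] := exists_other2 x v (sline_card dL).
  apply: (key L u (sline_sub dL) (sline_rk dL) Lx (sline_in dL) Lu _ uv).
  by have := subsetP sL u Lu; rewrite in_setU1 (negPf ux).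
- case=> [L [z [dL sL X2z]]].
  have Lv := sline_in dL.
  have xL : x \notin L by clear - sL xX1; set_dec.
  have wl1 : w \in l1 by rewrite el1 !inE Ww !orbT.
  have xl1 : x \in l1 by rewrite el1 !inE eqxx.
  have yl1 : y \in l1 by rewrite el1 !inE eqxx !orbT.
  have vl2 : v \in l2 by rewrite el2 !inE Vv orbT.
  have yl2 : y \in l2 by rewrite el2 !inE eqxx.
  have spanL p q a : p \in L -> q \in L -> p != q -> a \in E ->
      (exists l : {set T}, [/\ l \subset E, r l <= 2, p \in l, q \in l & a \in
        l]) -> a \in L.
    move=> Lp Lq pq aE [l [sl rl lp lq la]]; apply: (sline_flat dL) => //.
    by apply: (line_span hM hE sl rl lp lq pq) => //; apply: rk_mem.
  (* Such an [L] contains [y]. The cocircuit of [L] at [v] then meets [l1] in [y], so it also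
     contains [x] or [w]; [x] is impossible, and [w] puts all of [l1], with [x], into [L]. *)
  have key2 u : u \in L -> u != v -> u \in l2 -> False.
    move=> Lu uv l2u.
    have Ly : y \in L.
      by apply: (spanL u v) => //; [apply: (subsetP s2E) | exists l2].
    have xw : x != w by clear - xX1 eX1 Ww; set_dec.
    have yD : y \in z |: (L :\ v) by rewrite !inE Ly andbT [y == v]eq_sym vy
      orbT.
    have := line_cocirc hM hE (sline_coc dL) s1E rW xl1 wl1 xw yl1 yD.
    rewrite !inE (negPf xL) andbF orbF => /orP[/eqP exz|].
      by rewrite exz X2z in xX2.
    have -> /= : (w == z) = false.
      by apply/negP; clear - Ww eX1 X2z dis => /eqP ewz; rewrite -ewz in X2z;
        have : w \in X1 by [set_dec]; rewrite (disjointFl dis X2z).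
    case/andP=> _ Lw; move: xL; rewrite (spanL w y) //.
    + by clear - Ww yWV; set_dec.
    + by apply: (subsetP s1E).
    by exists l1.
  have [u [Lu uv _]] := exists_other2 v v (sline_card dL).
  have [u' [Lu' u'v u'u]] := exists_other2 v u (sline_card dL).
  have inW a : a \in L -> a != v -> a \in W.
    move=> La av; have := key2 a La av; have := subsetP sL a La.
    rewrite eX1 el2 !inE; case: (a == y) => /=; first by move=> _ /(_ isT).
    by case: (a \in W) => //= -> /(_ isT).
  apply: (N2 v Vv); apply: (line_span hM hE (sline_sub dL) (sline_rk dL) Lu' Lu
    u'u) => //.
    by rewrite rk_mem // el1 !inE inW // !orbT.
  by rewrite rk_mem // el1 !inE inW // !orbT.
case=> [W' [V' [w' [eX1' [_ Ww'] rW' _ [vWV' _]]]]].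
apply: (key (x |: (v |: W')) w'); rewrite ?inE ?eqxx ?Ww' ?orbT //.
- by clear - ptn eX1'; set_dec.
- by rewrite eX1' !inE Ww' orbT.
by clear - Ww' vWV'; set_dec.
Qed.

(** Lines from [inner_cases] that share a suitable point coincide ([same]), because their extra
    points lie in [X2]. If one of them lies inside [X1], it serves for all its points in [C].
    Otherwise all pass through [x], hence are one line containing all of [X1 :&: C], and [X1] turns
    out to be a spore part. *)
Lemma inner_line : exists2 L : {set T},
  (exists2 f, f \in L & (f \in C) && (f \in X1)) &
  forall y, y \in L -> y \in C -> exists v, spore_line L y v.
Proof.
have [hv Cx NX gX] := hX.
have [ptn dis xX1 xX2 sX1 sX2 rX12 rX1 rX2] := hv.
have sX1E : X1 \subset E by clear - ptn; set_dec.
have AB y : y \in X1 -> y \in C ->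
    (exists L z, [/\ spore_line L y z, x \in L, L \subset x |: X1 & z \in X2])
      \/
    (exists L z, [/\ spore_line L y z, L \subset X1 & z \in X2]).
  move=> X1y Cy.
  case: (inner_cases X1y Cy); [by left | by right |].
  by move/(no_two_lines X1y Cy).
have same L f z L' y z' u : spore_line L f z -> z \in X2 ->
  spore_line L' y z' ->
    L' \subset x |: X1 -> u \in L -> u \in L' -> u != f -> L' = L.
  move=> dL X2z dL' sL' Lu L'u uf.
  have zL' : z \notin L' by clear - sL' X2z dis xX2; set_dec.
  have [p [L'p pu _]] := exists_other2 u u (sline_card dL').
  have [q [L'q qu qp]] := exists_other2 u p (sline_card dL').
  have pq : p != q by rewrite eq_sym.
  have inL a : a \in L' -> a \in z |: (L :\ f) -> a \in L.
    by move=> L'a; rewrite !inE => /orP[/eqP ea|/andP[]//];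
      rewrite -ea L'a in zL'.
  have := line_cocirc hM hE (sline_coc dL) (sline_sub dL') (sline_rk dL') L'p
    L'q pq
    L'u (sline_cocE dL Lu uf).
  case/orP=> [/(inL _ L'p) Lp | /(inL _ L'q) Lq].
    exact: (line_eq dL dL' Lp Lu L'p L'u pu).
  exact: (line_eq dL dL' Lq Lu L'q L'u qu).
have [[f [X1f Cf [L [z [dL sL X2z]]]]] | NB] := classic (exists f, [/\ f \in
  X1, f \in C &
    exists L z, [/\ spore_line L f z, L \subset X1 & z \in X2]]).
  exists L; first by exists f; rewrite ?Cf //; apply: sline_in dL.
  move=> y Ly Cy; have [-> | yf] := eqVneq y f; first by exists z.
  have X1y := subsetP sL _ Ly.
  have [L' [z' [dL' sL']]] : exists L' z', spore_line L' y z' /\ L' \subset x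
    |: X1.
    case: (AB y X1y Cy) => [[L' [z' [? _ ? _]]] | [L' [z' [? s _]]]];
      exists L', z'; split=> //.
    by clear - s; set_dec.
  by exists z'; rewrite -(same _ _ _ _ _ _ y dL X2z dL' sL' Ly (sline_in dL')
    yf).
have A y : y \in X1 -> y \in C ->
    exists L z, [/\ spore_line L y z, x \in L, L \subset x |: X1 & z \in X2].
  move=> X1y Cy; case: (AB y X1y Cy) => // B; case: NB; exists y; split=> //.
have [y X1y Cy] : exists2 y, y \in X1 & y \in C.
  apply/exists_inP; apply: contraT; rewrite negb_exists_in => /forall_inP NC.
  have := cocirc_span (S := X1) cC Cx sX1E; rewrite sX1 => h.
  suff /h : [disjoint X1 & C] by rank_lia.
  by rewrite disjoints_subset; apply/subsetP=> u /NC; rewrite inE.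
have [L [z [dL Lx sL X2z]]] := A y X1y Cy.
have xy : x != y by apply: contraNneq xX1 => ->.
have yx : y != x by rewrite eq_sym.
have CL u : u \in X1 -> u \in C -> u \in L.
  move=> X1u Cu; have [L' [z' [dL' L'x sL' _]]] := A u X1u Cu.
  by rewrite -(same _ _ _ _ _ _ x dL X2z dL' sL' Lx L'x xy);
    apply: sline_in dL'.
exfalso; apply: Nspore; have rL := sline_rk dL; have Ly := sline_in dL.
have sLX : L :\ x \subset X1 by clear - sL; set_dec.
have eX : X1 = (L :\ x) :|: (X1 :\: L) by clear - sLX xX1; set_dec.
(* [X1 - L] avoids [C], so it does not span [y]; with [y] added it avoids the cocircuit of [L] at
   [y], so it does not span [x]. Two increases contradict [vertical3_line_rk]. *)
have [cA | cA] := leqP 2 #|X1 :\: L|.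
  have := vertical3_line_rk hM hE hv (sline_sub dL) rL Lx Ly yx sLX cA.
  have sA : X1 :\: L \subset E by clear - sX1E; set_dec.
  have dA : [disjoint X1 :\: L & C].
    by rewrite disjoints_subset; apply/subsetP=> u; rewrite !inE =>
      /andP[uL X1u]; apply: contra uL => /(CL u X1u).
  have := cocirc_span cC Cy sA dA.
  have syA : y |: (X1 :\: L) \subset E by clear - sA X1y sX1E; set_dec.
  have dyA : [disjoint y |: (X1 :\: L) & z |: (L :\ y)].
    by clear - X2z dis X1y; set_dec.
  have := cocirc_span (sline_coc dL) (sline_cocE dL Lx xy) syA dyA.
  have := @rk_mono _ M (x |: (y |: (X1 :\: L))) (x |: X1) ltac:(clear - X1y;
    set_dec).
  by rewrite sX1; rank_lia.
have [A0 | [a Aa]] := set_0Vmem (X1 :\: L).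
  have : X1 \subset L by rewrite -setD_eq0 A0.
  by move/(rk_mono M); rank_lia.
have [|c ec] := card1_of _ cA; first by apply/card_gt0P; exists a.
have ac : a = c by apply/set1P; rewrite -ec.
exists a; first by case/setDP: Aa.
have -> // : (x |: X1) :\ a = L.
clear - ec ac eX Lx Aa xX1; rewrite -ac in ec; set_dec.
Qed.
End Inner.

(** If every small part is a spore part, any one gives the line, and [sline_fan] identifies the
    lines at its other points. Otherwise take a smallest exception: either a small part lies
    strictly inside it, which is then a spore part, or none does. *)
Lemma exists_line x0 : x0 \in C -> good x0 -> exists2 L : {set T},
  (exists2 f, f \in L & f \in C /\ good f) &
  forall y, y \in L -> y \in C -> exists v, spore_line L y v.
Proof.
move=> Cx0 gx0; have [X0 [Y0 h0]] := small_part_exists Cx0 gx0.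
have [allI | ] := classic (forall X x Y, small_part X x Y -> spore_part X x).
  have [hv Cx NX gX] := h0.
  have [L [v [dL eX]]] := spore_part_line hv (allI _ _ _ h0).
  have gv : good v by apply: gX; clear - eX; set_dec.
  exists L; first by exists x0 => //; apply: sline_in dL.
  move=> y Ly Cy; have [-> | yx] := eqVneq y x0; first by exists v.
  have gy : good y by apply: gX; clear - eX Ly yx; set_dec.
  have [Z [Z' hZ]] := small_part_exists Cy gy.
  have [hZv _ _ _] := hZ.
  have [L' [v' [dL' _]]] := spore_part_line hZv (allI _ _ _ hZ).
  by exists v'; rewrite -(sline_fan dL Ly yx Cy gv dL').
move=> Nall; pose bad n := exists X x Y, [/\ small_part X x Y, ~ spore_part X x
  & #|X| = n].
have [n [[S [y0 [W [hS NS cS]]]] minn]] : exists n, bad n /\ forall m, m < n ->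
  ~ bad m.
  apply: NNPP => Nmin; apply: Nall => X x Y hX; apply: NNPP => NX.
  have : forall n, ~ bad n.
    elim/ltn_ind => n IH bn; apply: Nmin; exists n; split=> // m /IH; exact.
  by move/(_ #|X|); apply; exists X, x, Y.
have minS S' y' W' : small_part S' y' W' -> #|S'| < #|S| -> spore_part S' y'.
  move=> h; rewrite cS => lt; apply: NNPP => Nt; apply: (minn _ lt).
  by exists S', y', W'.
have [hv _ _ gS] := hS; have [_ _ y0S _ _ _ _ _ _] := hv.
have [[X [x [Z [hX pX]]]] | Ninner] := classic (exists X x Z, small_part X x Z
  /\
    x |: X \proper y0 |: S).
  have [sX _] := andP pX; have [hXv Cx _ gX] := hX.
  have [_ _ xX _ _ _ _ _ _] := hXv.
  have cX : #|X| < #|S|.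
    by have := proper_card pX; rewrite !cardsU1 xX y0S; rank_lia.
  have [L Lx dL] := inner_sline hS minS hX cX sX.
  by exists L => //; exists x => //; split=> //; apply: gX; rewrite setU11.
have [|L [f Lf /andP[Cf Sf]] dL] := inner_line hS NS.
  by move=> R y Z hR pR; apply: Ninner; exists R, y, Z.
by exists L => //; exists f => //; split=> //; apply: gS; rewrite inE Sf orbT.
Qed.

End Descent.

(** * Minors as rank conditions on an embedding *)

Section Minors.
Variables (T U : finType).
Implicit Types (M : matroid T) (N : matroid U) (C P : {set T}) (Z : {set U}).

(* [N] is the restriction of [M / C] to the image of [g]; [C] may contain
   elements outside the ground set. *)
Definition realizes M N C (g : U -> T) := [/\ {in ground N &, injective g},
  forall u, u \in ground N -> g u \in ground M,
  forall u, u \in ground N -> g u \notin C &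
  forall Z, Z \subset ground N -> rk M (g @: Z :|: C) = rk N Z + rk M C].

Lemma rkU_ground M A B : rk M (A :|: B) = rk M (A :|: (B :&: ground M)).
Proof.
rewrite rk_ground [RHS]rk_ground; congr (rk M _); apply/setP=> u.
by rewrite !inE; case: (u \in ground M); rewrite ?andbT ?andbF.
Qed.

Lemma realizes_ground M N C g : realizes M N C g ->
  realizes M N (C :&: ground M) g.
Proof.
move=> [injg gE gC gr]; split=> // [u Nu | Z sZ].
  by rewrite inE negb_and gC.
by rewrite -rkU_ground -rk_ground gr.
Qed.

(** [g] is the inverse of the isomorphism. The deleted set is not recorded, being whatever lies
    neither in [C] nor in the image of [g]. *)
Lemma has_minorP M N : 0 < #|ground N| ->
  has_minor M N <-> exists C g, realizes M N C g.
Proof.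
move=> /card_gt0P[u0 Nu0]; split.
  case=> C [D [sC sD dCD [f [injf imf rkf]]]].
  have inv u : u \in ground N -> exists z, f z = u.
    by rewrite -imf => /imsetP[z _ ->]; exists z.
  have [z0 fz0] := inv _ Nu0.
  (* The value [val z0] is taken only outside [ground N]; it makes [g] total. *)
  pose g u := if [pick z | f z == u] is Some z then val z else val z0.
  have gf z : g (f z) = val z.
    rewrite /g; case: pickP => [z' /eqP/injf-> // | /(_ z)].
    by rewrite eqxx.
  exists C, g; split.
  - move=> u u' /inv[z <-] /inv[z' <-]; rewrite !gf => /val_inj -> //.
  - by move=> u /inv[z <-]; rewrite gf; have := valP z; rewrite !inE =>
      /and3P[].
  - by move=> u /inv[z <-]; rewrite gf; have := valP z; rewrite !inE =>
      /and3P[].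
  move=> Z sZ; pose X := [set z | f z \in Z].
  have eZ : Z = [set f z | z in X].
    apply/setP=> u; apply/idP/imsetP=> [Zu | [z]].
      by have [z fz] := inv u (subsetP sZ u Zu); exists z; rewrite ?inE ?fz.
    by rewrite inE => fz ->.
  have eX : [set val z | z in X] = g @: Z.
    by rewrite eZ -imset_comp; apply: eq_imset => z /=; rewrite gf.
  have := rkf X; rewrite -eZ eX /= => ->.
  have -> : g @: Z :\: D = g @: Z.
    apply/setDidPl; rewrite -eX; apply/pred0P=> a /=; apply/negP.
    case/andP=> /imsetP[z _ ->] Dz; have := valP z.
    by rewrite !inE Dz.
  by rewrite subnK // rk_mono // subsetUr.
case=> C1 [g /realizes_ground].
move: (C1 :&: ground M) (subsetIr C1 (ground M)) => C sC [injg gE gC gr].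
have [D eD] : exists D, D = (ground M :\: C) :\: g @: ground N by eexists.
have sD : D \subset ground M by set_dec.
exists C, D.
have gND a : a \in (ground M :\: C) :\: D ->
  exists2 u, u \in ground N & g u = a.
  rewrite eD !inE; case: (a \in g @: ground N) / imsetP => [[u Nu ->] | _] /=.
    by exists u.
  by case: (a \in C); case: (a \in ground M).
split=> //; first by set_dec.
pose f (z : {x : T | x \in ground (delete (contract M C) D)}) :=
  odflt u0 [pick u in ground N | g u == val z].
have fg z : f z \in ground N /\ g (f z) = val z.
  rewrite /f; case: pickP => [u /andP[Nu /eqP gu] // | h].
  by have [u Nu gu] := gND _ (valP z); have := h u; rewrite Nu gu /= eqxx.
have imX (X : {set {x : T | x \in ground (delete (contract M C) D)}}) :
    g @: [set f z | z in X] = [set val z | z in X].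
  by rewrite -imset_comp; apply: eq_imset => z /=; case: (fg z).
exists f; split.
- by move=> z z' fzz'; apply: val_inj; rewrite -(fg z).2 -(fg z').2 fzz'.
- apply/setP=> u; apply/imsetP/idP=> [[z _ ->] | Nu]; first by case: (fg z).
  have Pu : g u \in ground (delete (contract M C) D).
      by rewrite /= eD !inE gE // gC //= (imset_f g Nu).
  exists (exist _ (g u) Pu) => //; have [Nf gf] := fg (exist _ (g u) Pu).
  by apply: injg => //; rewrite gf.
move=> X; have sX : [set f z | z in X] \subset ground N.
  by apply/subsetP=> _ /imsetP[z _ ->]; case: (fg z).
have := gr _ sX; rewrite imX /=.
have -> : [set val z | z in X] :\: D = [set val z | z in X].
  apply/setDidPl/pred0P=> a /=; apply/negP=> /andP[/imsetP[z _ ->] Dz].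
  by have := valP z; rewrite !inE Dz.
by move=> ->; rewrite addnK.
Qed.

Lemma realizes_contract M N C P g : P \subset C ->
  realizes M N C g -> realizes (contract M P) N C g.
Proof.
move=> sP [injg gE gC gr]; split=> // [u Nu | Z sZ] /=.
  by rewrite inE gE // andbT; apply: contra (gC u Nu); apply: (subsetP sP).
have eC : C :|: P = C by apply/setUidPl.
rewrite -setUA eC gr //; have := rk_mono M sP; lia.
Qed.

Lemma realizes_of_contract M N C P g :
  realizes (contract M P) N C g -> realizes M N (C :|: P) g.
Proof.
move=> [injg gE gC gr]; split=> // [u /gE | u Nu | Z sZ]; rewrite ?inE.
- by case/andP.
- by rewrite negb_or gC //; have := gE u Nu; rewrite inE => /andP[].
have := gr Z sZ => /=; rewrite setUA.
have := rk_mono M (subsetUr C P).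
have := rk_mono M (subsetUr (g @: Z :|: C) P); lia.
Qed.

End Minors.

(** * Rerouting a 3-connected minor across a partition of connectivity at most 1 *)

Section SmallSide.
Variables (T U : finType) (M : matroid T) (N : matroid U).
Hypotheses (hN : n_connected 3 N) (hN4 : 4 <= #|ground N|).
Local Notation E := (ground M).
Local Notation r := (rk M).
Variables (X Y : {set T}).
Hypotheses (sX : X \subset E) (sY : Y \subset E) (dXY : [disjoint X & Y]).
Hypotheses (sE : E \subset X :|: Y) (rXY : r X + r Y <= r E + 1).
Implicit Types (C W Z : {set T}).

(** Connectivity does not increase in minors, so two elements on each side would give a 2-separation
    of [N]. *)
Lemma small_side C g : realizes M N C g ->
  #|[set u in ground N | g u \in X]| <= 1 \/
  #|[set u in ground N | g u \in Y]| <= 1.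
Proof.
move/realizes_ground.
move: (C :&: E) (subsetIr C E) => {}C sC [injg gE gC gr].
set NX := [set u in _ | g u \in X]; set NY := [set u in _ | g u \in Y].
have [c1 | cX] := leqP #|NX| 1; first by left.
have [c2 | cY] := leqP #|NY| 1; first by right.
have sNX : NX \subset ground N by apply/subsetP=> u; rewrite inE => /andP[].
have sNY : NY \subset ground N by apply/subsetP=> u; rewrite inE => /andP[].
have dN : [disjoint NX & NY].
  rewrite -setI_eq0; apply/eqP/setP=> u; rewrite !inE.
  case: (u \in ground N) => //=; case Xu: (g u \in X) => //=.
  by rewrite (disjointFr dXY).
have sN : ground N \subset NX :|: NY.
  apply/subsetP=> u Nu; rewrite !inE Nu /=.
  by have := subsetP sE _ (gE u Nu); rewrite inE.
have := connectivity_ge hN hN4 (isT : 0 < 2 < 3) sNX sNY dN sN cX cY.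
have eN : NX :|: NY = ground N by apply/eqP; rewrite eqEsubset subUset sNX sNY.
have := gr _ sNX; have := gr _ sNY; have := gr _ (subxx _).
rewrite -{1}eN imsetU.
have [A eA] : exists A, A = g @: NX by exists (g @: NX).
have [B eB] : exists B, B = g @: NY by exists (g @: NY).
rewrite -eA -eB.
have sA : A \subset X.
  by rewrite eA; apply/subsetP=> _ /imsetP[u + ->]; rewrite inE => /andP[].
have sB : B \subset Y.
  by rewrite eB; apply/subsetP=> _ /imsetP[u + ->]; rewrite inE => /andP[].
clear - sA sB sX sY dXY sE rXY sC.
have := @rk_sub_submod _ M X C (X :|: C) (X :&: C) ltac:(set_dec)
  ltac:(set_dec) ltac:(set_dec).
have := @rk_sub_submod _ M Y C (Y :|: C) (Y :&: C) ltac:(set_dec)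
  ltac:(set_dec) ltac:(set_dec).
have := @rk_subU _ M (X :&: C) (Y :&: C) C ltac:(set_dec).
have := @rk_sub_submod _ M (X :|: C) (A :|: B :|: C) (X :|: B :|: C) (A :|: C)
  ltac:(set_dec) ltac:(set_dec) ltac:(set_dec).
have := @rk_sub_submod _ M (Y :|: C) (X :|: B :|: C) E (B :|: C)
  ltac:(set_dec) ltac:(set_dec) ltac:(set_dec).
rank_lia.
Qed.

(* Local connectivity d(Z, W) = r Z + r W - r (Z u W), for Z in X and W in Y:
   as d(X, Y) <= 1, it equals d(X, W) when d(Z, Y) = 1, and 0 otherwise.
   Hence it depends on Z only through d(Z, Y). *)
Lemma rk_transfer Z Z' W : Z \subset X -> Z' \subset X -> W \subset Y ->
  r Z + r (Z' :|: Y) = r Z' + r (Z :|: Y) ->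
  r (Z :|: W) + r Z' = r (Z' :|: W) + r Z.
Proof.
have bounds Z1 : Z1 \subset X -> W \subset Y ->
  [/\ r (Z1 :|: W) <= r Z1 + r W, r (Z1 :|: Y) <= r Z1 + r Y,
    r (Z1 :|: Y) + r W <= r (Z1 :|: W) + r Y,
    r (X :|: W) + r Z1 <= r (Z1 :|: W) + r X &
    r E + r (Z1 :|: W) <= r (Z1 :|: Y) + r (X :|: W)].
  move=> sZ sW; split; clear rXY.
  - by apply: rk_subU.
  - by apply: rk_subU.
  - by apply: rk_sub_submod; set_dec.
  - by apply: rk_sub_submod; set_dec.
  by apply: rk_sub_submod; set_dec.
move=> sZ sZ' sW; have [a1 a2 a3 a4 a5] := bounds Z sZ sW.
have [b1 b2 b3 b4 b5] := bounds Z' sZ' sW.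
have := @rk_subU _ M X W (X :|: W) (subxx _).
clear bounds; rank_lia.
Qed.

(** Says d(Z, Y) = 0. For [Z] in [X] the only other value is 1 ([cutF]), so this boolean is all that
    [rk_transfer] needs to know. *)
Let cut Z := rk M Z + rk M Y == rk M (Z :|: Y).

Lemma cutF Z : Z \subset X -> cut Z = false -> r Z + r Y = (r (Z :|: Y)).+1.
Proof.
move=> sZ /negbT/eqP; have := rk_subU M (subxx (Z :|: Y)).
have := @rk_sub_submod _ M (Z :|: Y) X E Z ltac:(set_dec) ltac:(set_dec)
  ltac:(set_dec).
rank_lia.
Qed.

Lemma cut_same Z Z' : Z \subset X -> Z' \subset X -> cut Z = cut Z' ->
  r Z + r (Z' :|: Y) = r Z' + r (Z :|: Y).
Proof.
move=> sZ sZ'; case cZ: (cut Z) => /esym cZ'.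
  by rewrite -(eqP cZ) -(eqP cZ'); lia.
by have := cutF sZ cZ; have := cutF sZ' cZ'; rank_lia.
Qed.

Lemma cutF_mono Z Z' : Z \subset Z' -> Z' \subset X -> cut Z = false ->
  cut Z' = false.
Proof.
move=> sZZ sZ' cZ; apply/negbTE; have := cutF (subset_trans sZZ sZ') cZ.
have := @rk_sub_submod _ M Z' (Z :|: Y) (Z' :|: Y) Z ltac:(set_dec)
  ltac:(set_dec) ltac:(set_dec).
by rewrite /cut => *; apply/eqP; rank_lia.
Qed.

Lemma cut_jump Z k : k |: Z \subset X -> cut Z -> cut (k |: Z) = false ->
  r (k |: Z) = (r Z).+1.
Proof.
move=> skZ /eqP cZ cZk; have := cutF skZ cZk; have := rkU1 M k Z.
have := @rk_mono _ M (Z :|: Y) (k |: Z :|: Y) ltac:(set_dec); rank_lia.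
Qed.

Lemma cut1 s : s \in X -> r (s |: Y) != r Y -> cut [set s].
Proof.
move=> Xs /eqP sY'; have := rk_mono M (subsetUr [set s] Y).
have := rk_le_card M [set s]; rewrite cards1.
have := rk_subU M (subxx (s |: Y)); rewrite /cut => *; apply/eqP; rank_lia.
Qed.

(** The part of [C] in [X], and the one element of [N] that may be there, can be replaced by any
    others with the same values of [cut]. It remains to choose the replacement so that [s] is
    contracted. *)
Lemma realizes_through C g s : realizes M N C g ->
  #|[set u in ground N | g u \in X]| <= 1 -> s \in X -> r (s |: Y) != r Y ->
  exists C' g', realizes M N C' g' /\ s \in C'.
Proof.
move/realizes_ground.
move: (C :&: E) (subsetIr C E) => {}C sC [injg gE gC gr] cX Xs Ys.
have [CX eCX] : exists CX, CX = C :&: X by eexists.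
have [CY eCY] : exists CY, CY = C :&: Y by eexists.
have eC : C = CX :|: CY by set_dec.
have sCX : CX \subset X by set_dec.
have sCY : CY \subset Y by set_dec.
have cs := cut1 Xs Ys; have ss : [set s] \subset X by rewrite sub1set.
have gXY u : u \in ground N -> g u \notin X -> g u \in Y.
  by move=> Nu; have := subsetP sE _ (gE u Nu); rewrite inE; case: (_ \in X).
have uniqX u v : u \in ground N -> v \in ground N -> g u \in X -> g v \in X ->
  u = v.
  move=> Nu Nv Xu Xv; apply: (card_le1_eqP cX); rewrite inE; exact/andP.
have main C1 g' k' : C1 \subset X -> cut C1 = cut CX -> s \in C1 ->
    {in ground N, forall u, g u \in Y -> g' u = g u} ->
    {in ground N, forall k, g k \in X -> [/\ g' k = k', k' \in X, k' \notin C1 &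
      cut (k' |: C1) = cut (g k |: CX) /\
      r (k' |: C1) + r CX = r (g k |: CX) + r C1]} ->
    exists C' g', realizes M N C' g' /\ s \in C'.
  move=> sC1 cC1 sC1s hg hk; exists (C1 :|: CY), g'.
  have tr Z : Z \subset Y -> r (CX :|: (Z :|: CY)) + r C1 = r (C1 :|: (Z :|:
    CY)) + r CX.
    by move=> sZ; apply: rk_transfer => //; [set_dec | apply: cut_same].
  have sgY (Z : {set U}) : Z \subset ground N -> (forall u, u \in Z ->
    g u \notin X) ->
      g' @: Z = g @: Z /\ g @: Z \subset Y.
    move=> sZ ZX; have hZ u : u \in Z -> g u \in Y.
      by move=> Zu; apply: gXY (ZX u Zu); apply: (subsetP sZ).
    split; first by apply: eq_in_imset => u Zu; apply: hg (hZ u Zu);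
      apply: (subsetP sZ).
    by apply/subsetP=> _ /imsetP[u /hZ Yu ->].
  have base := tr set0 (sub0set _); rewrite set0U -eC in base.
  split; last by rewrite inE sC1s.
  have gcase u : u \in ground N -> g u \in X \/ g u \in Y.
    by move=> Nu; have [|/(gXY _ Nu)] := boolP (g u \in X); [left | right].
  split.
  - move=> u v Nu Nv; case: (gcase u Nu) => gu; case: (gcase v Nv) => gv.
    + by move=> _; apply: uniqX.
    + have [-> Xk _ _] := hk u Nu gu; rewrite hg // => e.
      by move: Xk; rewrite e (disjointFl dXY gv).
    + have [-> Xk _ _] := hk v Nv gv; rewrite hg // => e.
      by move: Xk; rewrite -e (disjointFl dXY gu).
    by rewrite !hg //; apply: injg.
  - move=> u Nu; case: (gcase u Nu) => gu; last by rewrite hg // gE.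
    by have [-> Xk _ _] := hk u Nu gu; apply: (subsetP sX).
  - move=> u Nu; case: (gcase u Nu) => gu.
      have [-> Xk C1k _] := hk u Nu gu.
      rewrite inE negb_or C1k; apply/negP=> /(subsetP sCY).
      by rewrite (disjointFr dXY Xk).
    rewrite hg //; have := gC u Nu; rewrite eC !inE !negb_or.
    case/andP=> _ ->; rewrite andbT; apply/negP=> /(subsetP sC1).
    by rewrite (disjointFl dXY gu).
  move=> Z sZ; have [/exists_inP[k Zk Xgk] | ZX] := boolP [exists k in Z, g k
    \in X]; last first.
    have [|-> sgZ] := sgY Z sZ.
      by move=> u Zu; apply: contra ZX => Xu; apply/exists_inP; exists u.
    have := gr Z sZ; rewrite eC.
    have := tr _ sgZ; rewrite eC in base.
    by rewrite [g @: Z :|: (C1 :|: CY)]setUCA [g @: Z :|: (CX :|: CY)]setUCA;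
      clear - base; lia.
  have Nk := subsetP sZ k Zk; have [g'k Xk' C1k' [cut' rk']] := hk k Nk Xgk.
  have sZk : Z :\ k \subset ground N by set_dec.
  have [|eg' sgZ] := sgY _ sZk.
    move=> u /setD1P[uk Zu]; apply: contra uk => Xu; apply/eqP.
    by apply: uniqX => //; apply: (subsetP sZ).
  have := gr Z sZ.
  rewrite -(setD1K Zk) !imsetU1 g'k eg' eC; rewrite eC in base.
  have -> : k' |: g @: (Z :\ k) :|: (C1 :|: CY) = k' |: C1 :|: (g @: (Z :\ k)
    :|: CY).
    by rewrite -!setUA; congr (_ :|: _); rewrite setUCA.
  have -> : g k |: g @: (Z :\ k) :|: (CX :|: CY) = g k |: CX :|: (g @: (Z :\ k)
    :|: CY).
    by rewrite -!setUA; congr (_ :|: _); rewrite setUCA.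
  have s1 : g k |: CX \subset X by clear - Xgk sCX; set_dec.
  have s2 : k' |: C1 \subset X by clear - Xk' sC1; set_dec.
  have s3 : g @: (Z :\ k) :|: CY \subset Y by clear - sgZ sCY; set_dec.
  have := rk_transfer s1 s2 s3 (cut_same s1 s2 (esym cut')).
  clear - base rk'; lia.
have [NX0 | [k]] := set_0Vmem [set u in ground N | g u \in X].
  have gX u : u \in ground N -> (g u \in X) = false.
    move=> Nu; apply/negP=> Xu.
    by have : u \in set0 by [rewrite -NX0 inE Nu]; rewrite inE.
  (* No element of [N] is in [X]: the set [[set s]] or all of [X] has the required value of
     [cut]. *)
  have [cCX | cCX] := boolP (cut CX).
    by apply: (main [set s] g s) => //; [rewrite cs | rewrite set11 | move=> k
      /gX->].
  apply: (main X g s) => //; last by move=> k /gX->.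
  by rewrite (cutF_mono sCX (subxx X) (negbTE cCX)) (negbTE cCX).
rewrite inE => /andP[Nk Xk].
have skX : g k |: CX \subset X by clear - Xk sCX; set_dec.
have gkY u : u \in ground N -> u != k -> g u \in Y.
  move=> Nu uk; apply: gXY => //; apply: contra uk => Xu; apply/eqP;
    exact: uniqX.
have sNk : ground N :\ k \subset ground N by apply: subsetDl.
(* If adding [g k] did not change [cut], the element [k] would be a 1-separation of [N]. *)
have [cE | cNE] := eqVneq (cut CX) (cut (g k |: CX)).
  exfalso; have sk : [set k] \subset ground N by rewrite sub1set.
  have := connectivity_ge hN hN4 (isT : 0 < 1 < 3) sk sNk.
  move=> /(_ ltac:(clear; set_dec) ltac:(clear; set_dec)).
  rewrite cards1 => /(_ isT).
  have := cardsD1 k (ground N); rewrite Nk => cNk.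
  have := gr _ sk; have := gr _ sNk; have := gr _ (subxx _).
  rewrite -{1}(setD1K Nk) imsetU1 imset_set1.
  have sBY : g @: (ground N :\ k) \subset Y.
    by apply/subsetP=> _ /imsetP[u /setD1P[uk Nu] ->]; apply: gkY.
  move: (g @: (ground N :\ k)) sBY => B sBY.
  have sB : B :|: CY \subset Y by rewrite subUset sBY.
  have := rk_transfer sCX skX sB (cut_same sCX skX cE).
  have := rk_transfer sCX skX sCY (cut_same sCX skX cE).
  have -> : g k |: B :|: C = g k |: CX :|: (B :|: CY) by clear - eC; set_dec.
  have -> : B :|: C = CX :|: (B :|: CY) by clear - eC; set_dec.
  have -> : [set g k] :|: C = g k |: CX :|: CY by clear - eC; set_dec.
  rewrite -eC; clear - cNk hN4; lia.
have [cCX ckX] : cut CX /\ cut (g k |: CX) = false.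
  have sCk : CX \subset g k |: CX by apply: subsetUr.
  case e1: (cut CX) cNE; case e2: (cut (g k |: CX)) => //.
  by rewrite (cutF_mono sCk skX e1) in e2.
(* For a maximal such set [C1], any further element of [X] changes [cut] and can take the place of
   [g k]. *)
pose P (A : {set T}) := [&& A \subset X, cut A & s \in A].
have Ps : P [set s] by rewrite /P ss cs set11.
have [C1 /maxsetP[/and3P[sC1 cC1 sC1s] maxC1] _] := maxset_exists Ps.
have [k' Xk' C1k'] : exists2 k', k' \in X & k' \notin C1.
  apply/subsetPn; apply/negP=> sXC1; have eX : C1 = X by apply/eqP;
    rewrite eqEsubset sC1.
  by have := cutF_mono skX (subxx X) ckX; rewrite -eX cC1.
have sk'X : k' |: C1 \subset X by rewrite subUset sub1set Xk'.
have ck' : cut (k' |: C1) = false.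
  apply/negbTE/negP=> c; have : P (k' |: C1) by rewrite /P sk'X c inE sC1s orbT.
  by move/maxC1/(_ (subsetUr _ _)) => e; rewrite -e setU11 in C1k'.
apply: (main C1 (fun u => if u == k then k' else g u) k') => //.
- by rewrite cC1 cCX.
- move=> u Nu Yu; case: eqP => // eu; rewrite eu in Yu.
  by rewrite (disjointFr dXY Xk) in Yu.
move=> u Nu Xu; rewrite (uniqX _ _ Nu Nk Xu Xk) eqxx; split=> //.
split; first by rewrite ck' ckX.
by rewrite (cut_jump sk'X cC1 ck') (cut_jump skX cCX ckX); clear; lia.
Qed.

End SmallSide.

(** * The simplification of a loopless matroid *)

Section Simplification.
Variables (T : finType) (K : matroid T).
Local Notation E := (ground K).
Hypothesis loopless : forall u, u \in E -> rk K [set u] = 1.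

Lemma nonloopsE : nonloops K = E.
Proof.
apply/setP=> u; rewrite inE; case uE: (u \in E) => //=; apply/negP.
by case/minsetP=> /andP[_]; rewrite loopless // cards1.
Qed.

Lemma parallelE x y : x \in E -> y \in E ->
  parallel K x y = (rk K [set x; y] <= 1).
Proof.
move=> xE yE; rewrite /parallel; have [<- | xy] := eqVneq x y.
  by rewrite setUid loopless.
have cxy : #|[set x; y]| = 2 by rewrite cards2 xy.
have sxy : [set x; y] \subset E by rewrite subUset !sub1set xE.
apply/minsetP/idP=> [[/andP[_]] | r1]; first by rewrite cxy.
split=> [|B /andP[sB rB] sBxy]; first by rewrite /dependent sxy cxy.
apply/eqP; rewrite eqEcard sBxy cxy ltnNge; apply/negP=> cB.
have [B0 | [b Bb]] := set_0Vmem B; first by rewrite B0 cards0 in rB.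
have sb : [set b] \subset B by rewrite sub1set.
by have := rk_mono K sb; rewrite loopless ?(subsetP sB) //; lia.
Qed.

Lemma parallel_equiv : {in nonloops K & &, equivalence_rel (parallel K)}.
Proof.
rewrite nonloopsE => x y z xE yE zE; split; first by rewrite /parallel eqxx.
have tr a b c : a \in E -> b \in E -> c \in E -> rk K [set a; b] <= 1 ->
    rk K [set a; c] <= 1 -> rk K [set b; c] <= 1.
  move=> aE bE cE ab ac.
  have := @rk_sub_submod _ K [set a; b] [set a; c] [set b; c] [set a].
  move=> /(_ ltac:(clear; set_dec) ltac:(clear; set_dec) ltac:(clear; set_dec)).
  by rewrite loopless //; lia.
rewrite !parallelE // => xy; apply/idP/idP; first exact: tr.
by apply: tr => //; rewrite setUC.
Qed.

(** All that is used of [si]: [phi] sends an element to the representative of its parallel class. *)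
Lemma si_rep : exists S phi, [/\ ground (si K) = S, S \subset E,
  forall Z : {set T}, Z \subset S -> rk (si K) Z = rk K Z,
  forall u, u \in E -> phi u \in S /\ rk K [set u; phi u] <= 1 &
  forall s s', s \in S -> s' \in S -> rk K [set s; s'] <= 1 -> s = s'].
Proof.
have part := equivalence_partitionP parallel_equiv.
have trS := transversalP part.
set P := equivalence_partition _ _ in part trS.
set S := transversal _ _ in trS.
have sSE : S \subset E by rewrite -nonloopsE; apply: transversal_sub trS.
have [/eqP covP tiP _] := and3P part.
have pbE u v : u \in E -> v \in E -> (v \in pblock P u) = (rk K [set u;
  v] <= 1).
  move=> uE vE; rewrite -parallelE //.
  by rewrite (pblock_equivalence_partition parallel_equiv) ?nonloopsE.
exists S, (fun u => transversal_repr u S (pblock P u)); split=> //.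
- by rewrite /= -/S; clear - sSE; set_dec.
- move=> Z sZ /=; congr (rk K _); rewrite -/(parallel_classes K) -/S.
  by clear - sZ; set_dec.
- move=> u uE; have uP : u \in cover P by rewrite covP nonloopsE.
  have Pu : pblock P u \in P by apply: pblock_mem.
  split; first exact: (repr_mem_transversal trS).
  rewrite -pbE //; first exact: (repr_mem_pblock trS).
  by apply: (subsetP sSE); apply: (repr_mem_transversal trS).
move=> s s' Ss Ss' rss; apply: (pblock_inj trS) => //.
have sE := subsetP sSE _ Ss; have sE' := subsetP sSE _ Ss'.
by apply/esym/same_pblock => //; rewrite pbE // setUC.
Qed.

Lemma rk_parallel (S Z A : {set T}) phi : (forall u, u \in Z -> u \in E) ->
  S \subset E -> (forall u, u \in E -> phi u \in S /\ rk K [set u;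
    phi u] <= 1) ->
  (forall u, u \in Z -> phi u \in A) -> forall u, u \in Z ->
    rk K (u |: A) = rk K A.
Proof.
move=> ZE sS hphi ZA u Zu; have [Su ru] := hphi u (ZE u Zu).
apply: (@rk_span_mono _ _ _ [set phi u]); first by rewrite sub1set ZA.
rewrite (loopless (subsetP sS _ Su)); apply/eqP; rewrite eqn_leq ru.
by rewrite -(loopless (ZE u Zu)) rk_mono // subsetUl.
Qed.

(** Applying [phi] to everything preserves ranks. It causes no collisions because [N] has neither
    parallel elements nor loops. *)
Lemma si_minor (U : finType) (N : matroid U) C g : n_connected 3 N ->
  4 <= #|ground N| -> realizes K N C g -> has_minor (si K) N.
Proof.
move=> hN hN4 /realizes_ground.
move: (C :&: E) (subsetIr C E) => {}C sC [injg gE gC gr].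
have N0 : 0 < #|ground N| by lia.
apply/has_minorP => //.
have [S [phi [eS sS rS hphi Suniq]]] := si_rep.
have C1E : phi @: C \subset E.
  by apply/subsetP=> _ /imsetP[c Cc ->]; apply: (subsetP sS);
    apply: (hphi c (subsetP sC _ Cc)).1.
have inE' u : u \in ground N -> phi (g u) \in E.
  by move=> Nu; apply: (subsetP sS); apply: (hphi _ (gE u Nu)).1.
have par u : u \in E -> rk K (phi u |: [set u]) = rk K [set u] /\ rk K (u |:
  [set phi u]) = rk K [set phi u].
  move=> uE; have [Su ru] := hphi u uE; have pE := subsetP sS _ Su.
  have := rk_mono K (subsetUl [set u] [set phi u]).
  by rewrite [phi u |: _]setUC !loopless //; move=> *; split; lia.
have span1 (A B : {set T}) : A \subset E -> (forall u, u \in A ->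
  phi u \in B) ->
    forall u, u \in A -> rk K (u |: B) = rk K B.
  move=> sA AB u Au; apply: (@rk_span_mono _ _ _ [set phi u]);
    last exact: (par u (subsetP sA u Au)).2.
  by rewrite sub1set AB.
have span2 (A B : {set T}) : A \subset E -> A \subset B ->
    forall v, v \in phi @: A -> rk K (v |: B) = rk K B.
  move=> sA AB v /imsetP[u Au ->]; apply: (@rk_span_mono _ _ _ [set u]);
    last exact: (par u (subsetP sA u Au)).1.
  by rewrite sub1set (subsetP AB).
have rk_phi (A : {set T}) : A \subset E -> rk K (phi @: A) = rk K A.
  move=> sA; have e1 : rk K (A :|: phi @: A) = rk K (phi @: A).
    apply: (rk_span_set (S := A)) => //; first exact: subsetUr.
    by apply: span1 => // u Au; apply: imset_f.
  have e2 : rk K (A :|: phi @: A) = rk K A.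
    apply: (rk_span_set (S := phi @: A)); [exact: subsetUl |
      by rewrite setUC |].
    exact: span2.
  by rewrite -e1 e2.
exists (phi @: C), (phi \o g).
have sgE (Z : {set U}) : Z \subset ground N -> g @: Z \subset E.
  by move=> sZ; apply/subsetP=> _ /imsetP[u Zu ->]; apply: gE;
    apply: (subsetP sZ).
have SphiC : phi @: C \subset S.
  by apply/subsetP=> _ /imsetP[c Cc ->]; apply: (hphi c (subsetP sC _ Cc)).1.
have rkI (Z : {set U}) : Z \subset ground N ->
    rk (si K) ((phi \o g) @: Z :|: phi @: C) = rk K (g @: Z :|: C).
  move=> sZ; rewrite imset_comp -imsetU rS; first
    by rewrite rk_phi // subUset sgE.
  apply/subsetP=> _ /imsetP[u + ->]; rewrite inE => /orP[|Cu].
    by move/(subsetP (sgE _ sZ))=> uE; apply: (hphi u uE).1.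
  exact: (hphi u (subsetP sC _ Cu)).1.
split.
- move=> u u' Nu Nu' /= e; apply: contraTeq isT => uu'.
  have su : [set u; u'] \subset ground N by rewrite subUset !sub1set Nu.
  have su1 : [set u] \subset ground N by rewrite sub1set.
  have := gr _ su; have := gr _ su1; rewrite imsetU1 !imset_set1.
  rewrite (rk1 hN hN4 Nu) (rk2 hN hN4 Nu Nu' uu').
  have gu'1 : rk K (g u' |: [set g u]) = rk K [set g u].
    apply: (@rk_span_trans _ _ _ _ [set phi (g u)]); last by rewrite e;
      apply: (par _ (gE _ Nu')).2.
    by move=> y /set1P->; apply: (par _ (gE _ Nu)).1.
  have := rk_span_mono (subsetUl [set g u] C) gu'1.
  have -> : g u' |: ([set g u] :|: C) = [set g u; g u'] :|: C.
    by rewrite setUA [[set g u'] :|: _]setUC.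
  by clear; lia.
- by move=> u Nu; rewrite eS; apply: (hphi _ (gE u Nu)).1.
- move=> u Nu /=; apply/negP=> /imsetP[c Cc e].
  have cE := subsetP sC c Cc.
  have su1 : [set u] \subset ground N by rewrite sub1set.
  have := gr _ su1; rewrite imset_set1 (rk1 hN hN4 Nu).
  have gu1 : rk K (g u |: [set c]) = rk K [set c].
    apply: (@rk_span_trans _ _ _ _ [set phi c]); last by rewrite -e;
      apply: (par _ (gE _ Nu)).2.
    by move=> y /set1P->; apply: (par _ cE).1.
  have sc : [set c] \subset C by rewrite sub1set.
  by have := rk_span_mono sc gu1 => ->; lia.
move=> Z sZ; rewrite rkI // gr //; congr (_ + _).
by have := rkI set0 (sub0set _); rewrite !imset0 !set0U => ->.
Qed.

End Simplification.

(** * Contraction of a point, and the obstruction to a 3-connected simplification *)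

Section ContractPoint.
Variables (T : finType) (M : matroid T).
Local Notation E := (ground M).
Local Notation r := (rk M).
Hypotheses (hM : n_connected 3 M) (hE : 4 <= #|E|).
Implicit Types (X Y Z A B : {set T}) (x y : T).

Lemma rk_contract1 x Z : x \in E -> (rk (contract M [set x]) Z).+1 = r (x |: Z).
Proof.
move=> xE /=; rewrite (rk1 hM hE xE) setUC.
have := rk_mono M (subsetUl [set x] Z); rewrite (rk1 hM hE xE); lia.
Qed.

Lemma contract1_loopless x u : x \in E -> u \in ground (contract M [set x]) ->
  rk (contract M [set x]) [set u] = 1.
Proof.
move=> xE; rewrite !inE => /andP[ux uE].
by have := rk_contract1 [set u] xE; rewrite (rk2 hM hE) // 1?eq_sym // => -[].
Qed.

(** 3-connectivity gives r E + 2 <= r X + r (x |: Y) and the same with [x] on the other side.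
    Equality must hold throughout, so both sides span [x]. *)
Lemma vertical3_of_contract x X Y : (forall u, (u \in E) = [|| u == x, u \in X
  | u \in Y]) ->
  [disjoint X & Y] -> x \notin X -> x \notin Y ->
  r (x |: X) + r (x |: Y) <= r E + 2 -> 3 <= r (x |: X) -> 3 <= r (x |: Y) ->
  vertical3 M X x Y.
Proof.
move=> ptn dis xX xY rXY rX rY.
have sX : X \subset E by set_dec.
have sY : Y \subset E by set_dec.
have sxX : x |: X \subset E by set_dec.
have sxY : x |: Y \subset E by set_dec.
have cX : 2 <= #|X| by have := rk_le_card M X; have := rkU1 M x X; rank_lia.
have cY : 2 <= #|Y| by have := rk_le_card M Y; have := rkU1 M x Y; rank_lia.
have cX' : 2 <= #|x |: X| by apply: leq_trans cX (subset_leq_card (subsetUr _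
  _)).
have cY' : 2 <= #|x |: Y| by apply: leq_trans cY (subset_leq_card (subsetUr _
  _)).
have := connectivity_ge hM hE (isT : 0 < 2 < 3) sX sxY ltac:(set_dec)
  ltac:(set_dec) cX cY'.
have := connectivity_ge hM hE (isT : 0 < 2 < 3) sxX sY ltac:(set_dec)
  ltac:(set_dec) cX' cY.
have := rk_mono M (subsetUr [set x] X); have := rk_mono M (subsetUr [set x] Y).
by move=> *; split=> //; rank_lia.
Qed.

(** A separation of [si (M / x)] is pulled back along [phi] to a partition of [M / x] without
    raising ranks. *)
Lemma si_connected x : x \in E -> (forall X Y, ~ vertical3 M X x Y) ->
  n_connected 3 (si (contract M [set x])).
Proof.
move=> xE Nv3 k A hk; set K := contract M [set x].
have loopK u : u \in ground K -> rk K [set u] = 1 by apply: contract1_loopless.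
have [S [phi [eS sS rS hphi Suniq]]] := si_rep loopK.
apply/and4P; rewrite /connectivity eS => -[sA].
have [B eB] : exists B, B = S :\: A by eexists.
have sB : B \subset S by set_dec.
rewrite -eB !rS // => rAB cA cB.
have phiS u : u \in S -> phi u = u.
  move=> Su; have [Sp rp] := hphi u (subsetP sS u Su).
  by apply/esym; apply: Suniq.
have [X memX] : exists X : {set T}, forall u, (u \in X) = (u \in ground K) &&
  (phi u \in A).
  by exists [set u in ground K | phi u \in A]; move=> u; rewrite inE.
have [Y memY] : exists Y : {set T}, forall u, (u \in Y) = (u \in ground K) &&
  (phi u \in B).
  by exists [set u in ground K | phi u \in B]; move=> u; rewrite inE.
have rX : rk K X <= rk K A.
  have <- : rk K (X :|: A) = rk K A; last by apply: rk_mono; apply: subsetUl.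
  apply: (rk_span_set (S := X)) => //; first exact: subsetUr.
  by apply: (rk_parallel loopK) sS hphi _ => u; rewrite memX => /andP[].
have rY : rk K Y <= rk K B.
  have <- : rk K (Y :|: B) = rk K B; last by apply: rk_mono; apply: subsetUl.
  apply: (rk_span_set (S := Y)) => //; first exact: subsetUr.
  by apply: (rk_parallel loopK) sS hphi _ => u; rewrite memY => /andP[].
have rE : rk K (ground K) = rk K S.
  apply: (rk_span_set (S := ground K)) => //; first exact: subsetUl.
  by apply: (rk_parallel loopK _ sS hphi) => // u /hphi[].
have AX : A \subset X.
  by apply/subsetP=> u Au; have Su := subsetP sA u Au;
    rewrite memX phiS // Au (subsetP sS).
have BY : B \subset Y.
  by apply/subsetP=> u Bu; have Su := subsetP sB u Bu;
    rewrite memY phiS // Bu (subsetP sS).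
have xK : x \notin ground K by rewrite !inE eqxx.
have xX : x \notin X by rewrite memX (negPf xK).
have xY : x \notin Y by rewrite memY (negPf xK).
have ptn u : (u \in E) = [|| u == x, u \in X | u \in Y].
  have [-> | ux] := eqVneq u x; first by rewrite xE.
  have := hphi u; rewrite memX memY eB /= !inE ux /=; case: (u \in E) => //=.
  by case=> // -> _; case: (phi u \in A).
have dis : [disjoint X & Y].
  rewrite -setI_eq0; apply/eqP/setP=> u; rewrite inE memX memY eB !inE.
  by case: (phi u \in A); rewrite ?andbF.
have eX := rk_contract1 X xE; have eY := rk_contract1 Y xE.
have eE := rk_contract1 (ground K) xE.
have eKE : x |: ground K = E.
  by apply/setP=> u; rewrite !inE; case: eqP => [->|].
rewrite eKE in eE; rewrite -/K in eX eY eE.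
have rXY : r (x |: X) + r (x |: Y) <= r E + k.
  by clear - rAB rX rY rE eX eY eE; lia.
have sXE : X \subset E by clear - ptn; set_dec.
have sYE : Y \subset E by clear - ptn; set_dec.
have cX := leq_trans cA (subset_leq_card AX).
have cY := leq_trans cB (subset_leq_card BY).
(* For k = 1, one side has two elements since |E| >= 4, and [x] joins the other side to contradict
   3-connectivity of [M]. For k = 2, each side has two nonparallel elements, hence rank at least 3
   together with [x]. *)
have [k1 | k2] : k = 1 \/ k = 2 by clear - hk; lia.
  have claim X' Y' : X' \subset E -> Y' \subset E -> [disjoint X' & Y'] ->
    x \notin X' ->
      E \subset x |: (X' :|: Y') -> 2 <= #|X'| -> 1 <= #|Y'| -> x \notin Y' ->
      r (x |: X') + r (x |: Y') <= r E + k -> False.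
    move=> sX' sY' d' xX' sE' c2 c1 xY' r'.
    have sxY : x |: Y' \subset E by clear - sY' xE; set_dec.
    have cxY : 2 <= #|x |: Y'| by rewrite cardsU1 xY'; clear - c1; lia.
    have := connectivity_ge hM hE (isT : 0 < 2 < 3) sX' sxY ltac:(set_dec)
      ltac:(set_dec) c2 cxY.
    by have := rk_mono M (subsetUr [set x] X'); clear - k1 r'; lia.
  have [c2 | c2] := leqP 2 #|X|.
    by apply: (claim X Y) => //; [clear - ptn; set_dec | clear - cY k1; lia].
  apply: (claim Y X) => //; try by [rewrite disjoint_sym | rewrite addnC |
    clear - ptn; set_dec | clear - cX k1; lia].
  have cE : #|E| <= #|x |: (X :|: Y)| by apply: subset_leq_card; clear - ptn;
    set_dec.
  have := cardsU1 x (X :|: Y); have := cardsU X Y; clear - cE c2 hE.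
  by case: (x \notin _) => /=; lia.
have r3 Z Z' : Z \subset S -> 2 <= #|Z| -> Z \subset Z' -> 3 <= r (x |: Z').
  move=> sZ cZ sZZ; have [a [b [Za Zb ab]]] := card_gt1P cZ.
  have := rk_contract1 Z' xE; rewrite -/K.
  have sab : [set a; b] \subset Z' by clear - Za Zb sZZ; set_dec.
  have := rk_mono K sab; have : 1 < rk K [set a; b].
    rewrite ltnNge; apply/negP=> /(Suniq _ _ (subsetP sZ _ Za) (subsetP sZ _
      Zb)).
    exact/eqP.
  by clear; lia.
apply: (Nv3 X Y); apply: vertical3_of_contract => //.
- by rewrite k2 in rXY.
- by apply: (r3 A) AX => //; rewrite -k2.
- by apply: (r3 B) BY => //; rewrite -k2.
Qed.

End ContractPoint.

(** * Consequences of two or three partnered points on a line *)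

Section Spores.
Variables (T : finType) (M : matroid T).
Local Notation E := (ground M).
Local Notation r := (rk M).
Hypotheses (hM : n_connected 3 M) (hE : 4 <= #|E|).
Implicit Types (X Y Z A B L D P l : {set T}) (x y a v g s : T).
Local Notation vertical3 := (vertical3 M).
Local Notation spore_line := (spore_line M).

(** [L - g] lies on one side and both partners on the other. If that side had two elements off [L],
    adding [x] and then [x'] to them would raise the rank twice, by the two cocircuits, against
    [vertical3_line_rk]. So it exceeds [L - g] by one element. *)
Lemma two_slines_vertical3 L x v x' v' g Z1 Z2 : spore_line L x v ->
  spore_line L x' v' -> x != x' ->
  g \in L -> g != x -> g != x' -> vertical3 Z1 g Z2 ->
  exists2 a, spore_line L g a & Z1 = a |: (L :\ g) \/ Z2 = a |: (L :\ g).
Proof.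
move=> dL dL' xx' Lg gx gx'; have Lx := sline_in dL; have Lx' := sline_in dL'.
suff claim Y1 Y2 : vertical3 Y1 g Y2 -> x \in Y1 ->
  exists2 a, spore_line L g a & Y1 = a |: (L :\ g).
  move=> h; have := v3_part h x; rewrite (subsetP (sline_sub dL)) // eq_sym
    (negPf gx) /=.
  move=> /esym/orP[Z1x | Z2x]; first by have [a da e] := claim _ _ h Z1x;
    exists a; [|left].
  by have [a da e] := claim _ _ (vertical3C h) Z2x; exists a; [|right].
move=> h Y1x; have [sLY Y2v] := sline_vertical3_split hM hE dL Lg gx h Lx Y1x.
have Y1x' : x' \in Y1 by apply: (subsetP sLY); rewrite !inE eq_sym gx'.
have [_ Y2v'] := sline_vertical3_split hM hE dL' Lg gx' h Lx' Y1x'.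
have [ptn dis gY1 gY2 s1 s2 r12 r1 r2] := h.
have sLE := sline_sub dL; have rL := sline_rk dL.
have eY : Y1 = (Y1 :\: L) :|: (L :\ g) by clear - sLY gY1; set_dec.
have [cA | cA] := leqP 2 #|Y1 :\: L|.
  have xg : x != g by rewrite eq_sym.
  have := vertical3_line_rk hM hE h sLE rL Lg Lx xg sLY cA.
  have sA : Y1 :\: L \subset E by clear - ptn; set_dec.
  have sxA : x |: (Y1 :\: L) \subset E by clear - ptn Y1x; set_dec.
  have := cocirc_span (sline_coc dL') (sline_cocE dL' Lx xx') sA ltac:(clear -
    dis Y2v'; set_dec).
  have x'x : x' != x by rewrite eq_sym.
  have := cocirc_span (sline_coc dL) (sline_cocE dL Lx' x'x) sxA ltac:(clear -
    dis Y2v Lx Y1x; set_dec).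
  have := @rk_mono _ M (x' |: (x |: (Y1 :\: L))) Y1 ltac:(clear - Y1x Y1x';
    set_dec).
  by rank_lia.
have [A0 | [a Aa]] := set_0Vmem (Y1 :\: L).
  have : Y1 \subset L by rewrite -setD_eq0 A0.
  by move/(rk_mono M); rank_lia.
have [c ec] : exists c, Y1 :\: L = [set c].
  by apply/cards1P; rewrite eqn_leq -ltnS cA; apply/card_gt0P; exists a.
have eg : g |: (L :\ g) = L by rewrite setD1K.
exists c; last by rewrite -ec.
rewrite -eg; apply: (vertical3_spore_line hM hE (Y := Y2)).
- by rewrite -ec -eY.
- have : c \in Y1 :\: L by rewrite ec set11.
  by rewrite !inE => /andP[/negPf-> _]; rewrite andbF.
by rewrite eg.
Qed.

(** The two cocircuits have union [L + v + v'], so its complement is the intersection of two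
    distinct hyperplanes. *)
Lemma rk_compl_slines L x v x' v' : spore_line L x v -> spore_line L x' v' ->
  x != x' ->
  r (E :\: (L :|: [set v; v'])) + 2 <= r E.
Proof.
move=> dL dL' xx'; have [sD hD spD] := sline_coc dL;
  have [sD' hD' spD'] := sline_coc dL'.
have Lx := sline_in dL; have xE := subsetP (sline_sub dL) _ Lx.
have xD : x \notin v |: (L :\ x).
  by have := sline_out dL; rewrite !inE eqxx orbF; apply: contraNN => /eqP<-.
have := spD' x (sline_cocE dL' Lx xx').
have := @rk_sub_submod _ M (E :\: (v |: (L :\ x))) (E :\: (v' |: (L :\ x')))
  (x |: (E :\: (v' |: (L :\ x')))) (E :\: (L :|: [set v; v'])).
move=> /(_ ltac:(clear - xD xE; set_dec) ltac:(clear; set_dec) ltac:(clear;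
  set_dec)).
by rank_lia.
Qed.

Hypothesis rE4 : 4 <= r E.

Lemma rk_small_conn A : A \subset E -> 2 <= #|A| -> r A <= 3 ->
  r E <= r (E :\: A) + 1.
Proof.
move=> sA cA rA; have eA : E :\: (E :\: A) = A by set_dec.
have cB : 2 < #|E :\: A|.
  rewrite ltnNge; apply/negP=> /(rk_compl_small hM hE (subsetDl _ _)).
  by rewrite eA; rank_lia.
have := connectivity_ge hM hE (isT : 0 < 2 < 3) sA (subsetDl E A).
move=> /(_ ltac:(clear; set_dec) ltac:(clear; set_dec) cA (ltnW cB)).
by rank_lia.
Qed.

(** With a common partner, [v |: L] has rank 3 and a complement of rank at most r E - 2, which is
    too low a connectivity. *)
Lemma sline_inj L x v x' v' : spore_line L x v -> spore_line L x' v' ->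
  x != x' -> v != v'.
Proof.
move=> dL dL' xx'; apply/eqP=> evv; have := rk_compl_slines dL dL' xx'.
rewrite -evv setUid setUC; have vE := sline_outE dL; have sL := sline_sub dL.
have sA : v |: L \subset E by rewrite subUset sub1set vE.
have cA : 2 <= #|v |: L|.
  have := subset_leq_card (subsetUr [set v] L); have := sline_card dL.
  by clear; lia.
have rA := sline_out_rk hM hE dL vE (sline_out dL).
by have := rk_small_conn sA cA; rewrite rA => /(_ isT); clear; lia.
Qed.

(** Another line through [g] meets [L] in [g] only, so each of the two cocircuits can meet it again
    only in its partner. Then [v] and [v'] lie on it, and [L + v + v'] has rank at most 3, against
    [rk_compl_slines]. *)
Lemma line_unique L x v x' v' g l : spore_line L x v -> spore_line L x' v' ->
  x != x' ->
  g \in L -> g != x -> g != x' -> l \subset E -> r l <= 2 -> g \in l ->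
  3 <= #|l| -> l \subset L.
Proof.
move=> dL dL' xx' Lg gx gx' sl rl lg cl; have vv' := sline_inj dL dL' xx'.
apply/subsetPn=> -[p lp Lp].
have sL := sline_sub dL; have rL := sline_rk dL.
have notL u : u \in l -> u != g -> u \notin L.
  move=> lu ug; apply: contra Lp => Lu.
  apply: (sline_flat dL); first exact: (subsetP sl).
  by apply: (line_span hM hE sl rl lu lg ug) => //; apply: rk_mem.
have pg : p != g by apply: contraNneq Lp => ->.
have [q [lq qg qp]] := exists_other2 g p cl; have pq : p != q by rewrite eq_sym.
have Lq := notL q lq qg.
have pv y w : spore_line L y w -> g != y -> (p == w) || (q == w).
  move=> dy gy; have := line_cocirc hM hE (sline_coc dy) sl rl lp lq pq lg
    (sline_cocE dy Lg gy).
  by rewrite !inE (negPf Lp) (negPf Lq) !andbF !orbF.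
have sA : L :|: [set v; v'] \subset L :|: l.
  apply: setUS; rewrite subUset !sub1set.
  have := pv _ _ dL gx; have := pv _ _ dL' gx'.
  by case/orP=> /eqP <-; case/orP=> /eqP <-; rewrite ?lp ?lq.
have vE := sline_outE dL; have vE' := sline_outE dL'.
have sAE : L :|: [set v; v'] \subset E by clear - sL vE vE'; set_dec.
have cA : 2 <= #|L :|: [set v; v']|.
  have := subset_leq_card (subsetUl L [set v; v']); have := sline_card dL.
  by clear; lia.
have rA : r (L :|: [set v; v']) <= 3.
  have gE := subsetP sL g Lg.
  have := @rk_sub_submod _ M L l _ [set g] sA.
  rewrite (rk1 hM hE gE) => /(_ ltac:(clear - Lg; set_dec) ltac:(clear - lg;
    set_dec)).
  by clear - rL rl; lia.
have := rk_small_conn sAE cA rA; have := rk_compl_slines dL dL' xx'.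
by clear; lia.
Qed.

(** For two partners, the intersection [I] of the hyperplanes has rank at most r E - 2 and contains
    [g]. One more point of [L] makes it span all of [E] but [a] and [s], which still needs rank r
    E. *)
Lemma sline_unique L g a s : spore_line L g a -> cocirc M (s |: (L :\ g)) ->
  s != g -> s = a.
Proof.
move=> dL cD' sg; have cD := sline_coc dL; have [sD hD spD] := cD;
  have [sD' hD' spD'] := cD'.
have sE : s \in E by clear - sD'; set_dec.
have Lg := sline_in dL; have aL := sline_out dL; have aE := sline_outE dL.
have gE := subsetP (sline_sub dL) g Lg; have sL := sline_sub dL.
apply/eqP; apply: contraT => sa.
have [h [Lh hg _]] := exists_other2 g g (sline_card dL).
have aD : a \in E :\: (s |: (L :\ g)) by clear - aL aE sa; set_dec.
have [I eI] : exists I, I = E :\: (L :\ g :|: [set a; s]) by eexists.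
have := @rk_sub_submod _ M (E :\: (a |: (L :\ g))) (E :\: (s |: (L :\ g)))
  (a |: (E :\: (a |: (L :\ g)))) I.
move=> /(_ ltac:(clear - aD; set_dec) ltac:(clear - eI;
  set_dec) ltac:(clear - eI; set_dec)).
rewrite (spD a (setU11 _ _)).
have Ig : g \in I.
  have ga : g != a by apply: contraNneq aL => <-.
  by clear - eI Lg gE ga sg; set_dec.
have e1 : r (L :|: (h |: I)) = r (h |: I).
  apply: (rk_span_set (S := L)) => [||u Lu]; [exact: subsetUr | exact: subxx |].
  by apply: (line_span hM hE sL (sline_rk dL) Lh Lg hg) => //;
    rewrite rk_mem // !inE ?eqxx ?Ig ?orbT.
have sas : [set a; s] \subset E by clear - aE sE; set_dec.
have cas : #|[set a; s]| <= 2 by rewrite cards2; case: (_ != _).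
have := rk_compl_small hM hE sas cas.
have := @rk_mono _ M (E :\: [set a; s]) (L :|: (h |: I)) ltac:(clear - eI;
  set_dec).
have := rkU1 M h I; rewrite e1; clear - hD hD'; lia.
Qed.

Lemma cocirc_contract1 g D : g \in E ->
  cocirc (contract M [set g]) D <-> cocirc M D /\ g \notin D.
Proof.
move=> gE; have e Z : (rk (contract M [set g]) Z).+1 = r (g |: Z)
  by apply: rk_contract1.
have eE : g |: (E :\: [set g]) = E by rewrite setD1K.
split=> [[sD hD spD] | [[sD hD spD] gD]].
  have gD : g \notin D by apply/negP=> /(subsetP sD); rewrite !inE eqxx.
  have eD : g |: ((E :\: [set g]) :\: D) = E :\: D by clear - gE gD; set_dec.
  split=> //; split.
  - exact: subset_trans sD (subsetDl _ _).
  - by have := e (ground (contract M [set g]) :\: D);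
      have := e (ground (contract M [set g])); rewrite eD eE -hD => <- ->.
  move=> u Du; have := e (u |: (ground (contract M [set g]) :\: D)).
  by rewrite spD // e eE setUCA eD.
have eD : g |: ((E :\: [set g]) :\: D) = E :\: D by clear - gE gD; set_dec.
split.
- by clear - sD gD; rewrite /=; set_dec.
- by have := e (ground (contract M [set g]) :\: D);
    have := e (ground (contract M [set g])); rewrite eD eE => *; lia.
move=> u Du; have := e (u |: (ground (contract M [set g]) :\: D)).
rewrite setUCA eD spD // -eE => h; apply/eqP; rewrite -eqSS; apply/eqP.
by rewrite h e.
Qed.

Lemma contract1_conn g X Y : (forall u, (u \in E) = [|| u == g, u \in X | u \in
  Y]) ->
  [disjoint X & Y] -> g \notin X -> g \notin Y -> 1 <= #|X| -> 1 <= #|Y| ->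
  r E + 2 <= r (g |: X) + r (g |: Y).
Proof.
have claim X' Y' : (forall u, (u \in E) = [|| u == g, u \in X' | u \in Y']) ->
    [disjoint X' & Y'] -> g \notin X' -> g \notin Y' -> 2 <= #|X'| ->
      1 <= #|Y'| ->
    r E + 2 <= r (g |: X') + r (g |: Y').
  move=> ptn dis gX gY cX cY.
  have sX : X' \subset E by set_dec.
  have sgY : g |: Y' \subset E by set_dec.
  have cgY : 2 <= #|g |: Y'| by rewrite cardsU1 gY; clear - cY; lia.
  have := connectivity_ge hM hE (isT : 0 < 2 < 3) sX sgY ltac:(set_dec)
    ltac:(set_dec) cX cgY.
  by have := rk_mono M (subsetUr [set g] X'); clear; lia.
move=> ptn dis gX gY cX cY; have [c2 | c2] := leqP 2 #|X|; first exact: claim.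
rewrite [X in _ <= X]addnC; apply: claim => //.
- by move=> u; rewrite ptn [X in _ || X]orbC.
- by rewrite disjoint_sym.
have sE : E \subset g |: (X :|: Y) by clear - ptn; set_dec.
have := subset_leq_card sE; have := cardsU1 g (X :|: Y); have := cardsU X Y.
by clear - c2 hE; case: (g \notin _) => /=; lia.
Qed.

(** A spore of [M / g] or a side of low rank is a line of [M] through [g], so [line_unique] puts it
    into [L]. All other 2-separations come from vertical 3-partitions, which [two_slines_vertical3]
    describes. *)
Lemma unique_spore L x v x' v' g a : spore_line L x v -> spore_line L x' v' ->
  x != x' ->
  spore_line L g a -> g != x -> g != x' ->
  three_connected_up_to_unique_spore (contract M [set g]) (L :\ g) a.
Proof.
move=> dL dL' xx' dg gx gx'; have Lg := sline_in dg; have sL := sline_sub dg.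
have gE := subsetP sL g Lg; have aE := sline_outE dg; have aL := sline_out dg.
have e Z : (rk (contract M [set g]) Z).+1 = r (g |: Z) by apply: rk_contract1.
have eL : g |: (L :\ g) = L by rewrite setD1K.
have rL := sline_rk2 hM hE dg.
have ag : a != g by apply: contraNneq aL => ->.
have rKL : rk (contract M [set g]) (L :\ g) = 1 by have := e (L :\ g);
  rewrite eL rL => -[].
split.
- apply/and4P; split.
  + apply/andP; split; first by rewrite /=; clear - sL; set_dec.
    apply/eqP/setP=> u; rewrite !inE; case: (eqVneq u g) => //= ug.
    rewrite -eqSS !e setUCA eL.
    case uE: (u \in E) => /=; last by apply/esym/negP=> /(subsetP sL);
      rewrite uE.
    by apply/eqP/idP=> [h | Lu]; [apply: (sline_flat dg) | apply: rk_mem].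
  + by rewrite rKL.
  + by rewrite !inE ag aE.
  apply/cocircuitP/cocirc_contract1 => //; split; first exact: sline_coc.
  by rewrite !inE eqxx orbF eq_sym.
- move=> P s /and4P[/andP[sP /eqP clP] /eqP rP sE /cocircuitP/cocirc_contract1].
  case=> // cD gD; have gP : g \notin P by clear - gD; set_dec.
  have sg : s != g by clear - gD; set_dec.
  have sPE : P \subset E by apply: subset_trans sP (subsetDl _ _).
  have rl : r (g |: P) = 2 by rewrite -e rP.
  have sl : g |: P \subset E by rewrite subUset sub1set gE.
  have cP : 2 <= #|P|.
    by have := cocirc_card hM hE cD; rewrite cardsU1; clear;
      case: (_ \notin _) => /=; lia.
  have cl : 3 <= #|g |: P| by rewrite cardsU1 gP.
  have slL := line_unique dL dL' xx' Lg gx gx' sl (eq_leq rl) (setU11 _ _) cl.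
  have eP : P = L :\ g.
    apply/eqP; rewrite eqEsubset; apply/andP; split; first by clear - slL gP;
      set_dec.
    have [p Pp] : exists p, p \in P by apply/card_gt0P; apply: ltnW.
    have pg : p != g by apply: contraNneq gP => <-.
    have Lp : p \in L by clear - slL Pp; set_dec.
    apply/subsetP=> u /setD1P[ug Lu]; rewrite -clP !inE ug (subsetP sL) //=.
    rewrite -eqSS !e setUCA; apply/eqP.
    by apply: (line_span hM hE sL (eq_leq rL) Lp Lg pg) => //;
      rewrite rk_mem // !inE ?eqxx ?Pp ?orbT.
  by split=> //; apply: (sline_unique dg) sg; rewrite -eP.
move=> k X hk /and4P[sX].
have [Y eY] : exists Y, Y = ground (contract M [set g]) :\: X by eexists.
rewrite /connectivity -eY => rXY cX cY.
have gX : g \notin X by apply/negP=> /(subsetP sX); rewrite !inE eqxx.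
have gY : g \notin Y by rewrite eY !inE eqxx andbF.
have ptn u : (u \in E) = [|| u == g, u \in X | u \in Y].
  have [-> | ug] := eqVneq u g; first by rewrite gE.
  rewrite eY !inE ug /=; case Xu: (u \in X) => //=.
  by have := subsetP sX u Xu; rewrite !inE => /andP[_ ->].
have dis : [disjoint X & Y] by clear - eY; set_dec.
have := e (ground (contract M [set g])); rewrite /= setD1K //.
have := e X; have := e Y; rewrite /= => eX' eY' eE'.
have rk_le : r (g |: X) + r (g |: Y) <= r E + k by move: rXY; rewrite /=;
  clear - eX' eY' eE'; lia.
have [k1 | k2] : k = 1 \/ k = 2 by clear - hk; lia.
  have cX1 : 1 <= #|X| by rewrite -k1. have cY1 : 1 <= #|Y| by rewrite -k1.
  by have := contract1_conn ptn dis gX gY cX1 cY1; clear - rk_le k1; lia.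
have small Z : Z \subset E -> g \notin Z -> k <= #|Z| -> r (g |: Z) <= 2 ->
  Z \subset a |: (L :\ g).
  move=> sZ gZ cZ rZ; have sl : g |: Z \subset E by rewrite subUset sub1set gE.
  have cl : 3 <= #|g |: Z| by rewrite cardsU1 gZ; clear - cZ k2; lia.
  have := line_unique dL dL' xx' Lg gx gx' sl rZ (setU11 _ _) cl.
  by move=> slL; clear - gZ slL; set_dec.
have [rX | rX] := leqP 3 (r (g |: X)); last first.
  by left; apply: small => //; clear - ptn; set_dec.
have [rY | rY] := leqP 3 (r (g |: Y)); last first.
  by right; apply: small => //; clear - ptn; set_dec.
rewrite k2 in rk_le; have h := vertical3_of_contract hM hE ptn dis gX gY rk_le
  rX rY.
have [b db eb] := two_slines_vertical3 dL dL' xx' Lg gx gx' h.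
have eba : b = a.
  by apply: (sline_unique dg (sline_coc db));
    apply: contraNneq (sline_out db) => ->.
by rewrite -eba; case: eb => <-; [left | right].
Qed.

(** Two of the three partners avoid the same side. By their cocircuits that side gains rank 2 from
    [L], so it keeps its rank in [M / L], and the separation would be one of [M]. *)
Lemma contract_line_conn L x1 x2 x3 v1 v2 v3 : spore_line L x1 v1 ->
  spore_line L x2 v2 ->
  spore_line L x3 v3 -> x1 != x2 -> x1 != x3 -> x2 != x3 ->
    n_connected 3 (contract M L).
Proof.
move=> d1 d2 d3 x12 x13 x23 k X hk; apply/and4P=> -[sX].
have [Y eY] : exists Y, Y = ground (contract M L) :\: X by eexists.
rewrite /connectivity -eY => rXY cX cY.
have rL := sline_rk2 hM hE d1; have sL := sline_sub d1.
have claim x x' v v' Z (W : {set T}) : spore_line L x v ->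
  spore_line L x' v' -> x != x' ->
    v \notin Z -> v' \notin Z -> Z \subset E :\: L -> W \subset E :\: L ->
    E :\: L \subset Z :|: W -> [disjoint Z & W] -> k <= #|Z| -> k <= #|W| ->
    r E + 2 + k <= r (Z :|: L) + r (W :|: L).
  move=> dx dx' xx' vZ v'Z sZ sW sZW dZW cZ cW.
  have Lx := sline_in dx; have Lx' := sline_in dx'; have x'x : x' != x
    by rewrite eq_sym.
  have sZE : Z \subset E by clear - sZ; set_dec.
  have sxZE : x |: Z \subset E by clear - sZE Lx sL; set_dec.
  have := cocirc_span (sline_coc dx') (sline_cocE dx' Lx xx') sZE ltac:(clear -
    v'Z sZ; set_dec).
  have xv : x != v by apply: contraNneq (sline_out dx) => <-.
  have := cocirc_span (sline_coc dx) (sline_cocE dx Lx' x'x) sxZE ltac:(clear -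
    vZ sZ Lx xv; set_dec).
  have := @rk_mono _ M (x' |: (x |: Z)) (Z :|: L) ltac:(clear - Lx Lx';
    set_dec).
  have sWL : W :|: L \subset E by clear - sW sL; set_dec.
  have cWL : k <= #|W :|: L| by apply: leq_trans cW (subset_leq_card (subsetUl
    _ _)).
  have := connectivity_ge hM hE hk sZE sWL ltac:(clear - sZ dZW;
    set_dec) ltac:(clear - sZW; set_dec) cZ cWL.
  by clear; lia.
have eE : E :\: L :|: L = E by clear - sL; set_dec.
have rXY' : r (X :|: L) + r (Y :|: L) < r E + 2 + k.
  have := rk_mono M (subsetUr X L); have := rk_mono M (subsetUr Y L).
  have := rk_mono M sL; move: rXY; rewrite /= eE rL; clear; lia.
have sY : Y \subset E :\: L by rewrite eY /=; clear; set_dec.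
have sXL : X \subset E :\: L by [].
have dXY : [disjoint X & Y] by clear - eY; set_dec.
have sXY : E :\: L \subset X :|: Y by rewrite eY /=; clear; set_dec.
have two x x' v v' : spore_line L x v -> spore_line L x' v' -> x != x' ->
    ((v \notin X) && (v' \notin X)) || ((v \notin Y) && (v' \notin Y)) -> False.
  move=> dx dx' xx' /orP[] /andP[Nv Nv'].
    have := claim _ _ _ _ X Y dx dx' xx' Nv Nv' sXL sY sXY dXY cX cY.
    by clear - rXY'; lia.
  have := claim _ _ _ _ Y X dx dx' xx' Nv Nv' sY sXL.
  rewrite [Y :|: X]setUC disjoint_sym => /(_ sXY dXY cY cX).
  by clear - rXY'; lia.
have NXY w : (w \notin X) || (w \notin Y) by clear - dXY;
  move: (mem_disjoint w dXY); rewrite negb_and.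
have := two _ _ _ _ d1 d2 x12; have := two _ _ _ _ d1 d3 x13.
have := two _ _ _ _ d2 d3 x23; have := NXY v1; have := NXY v2; have := NXY v3.
clear; case: (v1 \notin X); case: (v2 \notin X); case: (v3 \notin X);
case: (v1 \notin Y); case: (v2 \notin Y); case: (v3 \notin Y); rewrite //=;
  intuition.
Qed.

End Spores.

(** * Keeping the minor when points or the whole line are contracted *)

Section WithMinor.
Variables (T U : finType) (M : matroid T) (N : matroid U).
Local Notation E := (ground M).
Local Notation r := (rk M).
Hypotheses (hM : n_connected 3 M) (hE : 4 <= #|E|).
Hypotheses (hN : n_connected 3 N) (hN4 : 4 <= #|ground N|).
Implicit Types (X Y A B C L D P : {set T}) (x y a v s : T) (g : U -> T).
Local Notation vertical3 := (vertical3 M).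
Local Notation spore_line := (spore_line M).
Local Notation con P := (contract M P).

Let N0 : 0 < #|ground N|. Proof. exact: leq_trans hN4. Qed.

Lemma has_minor_contractP P : P \subset E ->
  has_minor (con P) N <-> exists C g, realizes M N C g /\ P \subset C.
Proof.
move=> sP; split=> [/(has_minorP _ N0)[C [g /realizes_of_contract h]] | [C [g
  [h sPC]]]].
  by exists (C :|: P), g; split=> //; apply: subsetUr.
by apply/(has_minorP _ N0); exists C, g; apply: realizes_contract.
Qed.

Lemma has_minor_contract_sub P P' : P' \subset E -> P \subset P' ->
  has_minor (con P') N -> has_minor (con P) N.
Proof.
move=> sP' sP /(has_minor_contractP sP')[C [g [h sPC]]].
apply/has_minor_contractP; first exact: subset_trans sP'.
by exists C, g; split=> //; apply: subset_trans sPC.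
Qed.

(** Elements spanned by [C] are loops after its contraction, and [N] has no loops. *)
Lemma realizes_span C L g : realizes M N C g ->
  (forall u, u \in L -> r (u |: C) = r C) -> realizes M N (C :|: L) g.
Proof.
move=> [injg gE gC gr] spanL.
have eCL A : C \subset A -> r (A :|: L) = r A.
  move=> sCA; apply: (rk_span_set (S := L)); [exact: subsetUl |
    by rewrite setUC |].
  by move=> u Lu; apply: rk_span_mono sCA _; apply: spanL.
split=> // [u Nu | Z sZ].
  rewrite inE negb_or gC //=; apply/negP=> /spanL spang.
  have sNu : [set u] \subset ground N by rewrite sub1set.
  by have := gr _ sNu; rewrite imset_set1 spang (rk1 hN hN4 Nu); clear; lia.
by rewrite setUA !eCL ?gr // subsetUr.
Qed.

Lemma vertical3_side x X Y : vertical3 X x Y -> has_minor (con [set x]) N ->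
  exists X Y, vertical3 X x Y /\
   forall s, s \in X -> r (s |: Y) != r Y -> has_minor (con [set s]) N.
Proof.
move=> h /(has_minorP _ N0)[C [g hr]].
have xE : x \in E by rewrite (v3_part h) eqxx.
have e Z : (rk (con [set x]) Z).+1 = r (x |: Z) by apply: rk_contract1.
have claim X1 Y1 : vertical3 X1 x Y1 -> [/\ X1 \subset ground (con [set x]),
    Y1 \subset ground (con [set x]), [disjoint X1 & Y1],
    ground (con [set x]) \subset X1 :|: Y1 &
    rk (con [set x]) X1 + rk (con [set x]) Y1 <= rk (con [set x]) (ground (con
      [set x])) + 1].
  move=> [ptn dis xX xY sX sY rXY _ _]; split=> //; rewrite /=; try set_dec.
  have := e (ground (con [set x])); have := e X1; have := e Y1.
  by rewrite /= setD1K // sX sY; clear - rXY; lia.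
have through X1 Y1 : vertical3 X1 x Y1 -> #|[set u in ground N | g u \in X1]|
  <= 1 ->
    forall s, s \in X1 -> r (s |: Y1) != r Y1 -> has_minor (con [set s]) N.
  move=> h1 c1 s Xs Ys; have [sX sY dXY sE rXY] := claim _ _ h1.
  have NKs : rk (con [set x]) (s |: Y1) != rk (con [set x]) Y1.
    rewrite -eqSS !e (v3_spanY h1); apply: contraNneq Ys => eq.
    rewrite eqn_leq [X in _ && X]rk_mono ?subsetUr // andbT -eq.
    by apply: rk_mono; set_dec.
  have [C' [g' [hr' C's]]] := realizes_through hN hN4 sX sY dXY sE rXY hr c1 Xs
    NKs.
  have sE1 : s \in E by rewrite (v3_part h1) Xs orbT.
  apply/has_minor_contractP; first by rewrite sub1set.
  by exists (C' :|: [set x]), g'; split; [apply: realizes_of_contract | rewrite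
    sub1set inE C's].
have [sX sY dXY sE rXY] := claim _ _ h.
case: (small_side hN hN4 sX sY dXY sE rXY hr) => c1.
  by exists X, Y; split=> //; apply: through.
by exists Y, X; split; [apply: vertical3C | apply: through (vertical3C h) c1].
Qed.

(** In [M / f] the set [(L - f) + v] is one side of a partition of connectivity at most 1. If its
    complement carried at most one element of [N], then [N] would have at most three: that one, [v],
    and one from the parallel class [L - f]. So a second point of [L] can be contracted, after which
    the rest of [L] consists of loops. *)
Lemma contract_line_minor L f v : spore_line L f v ->
  has_minor (con [set f]) N ->
  has_minor (con L) N.
Proof.
move=> dL /(has_minorP _ N0)[C [g hr]].
have Lf := sline_in dL; have sL := sline_sub dL; have fE := subsetP sL f Lf.
have [sD hD spD] := sline_coc dL; have vL := sline_out dL.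
have e Z : (rk (con [set f]) Z).+1 = r (f |: Z) by apply: rk_contract1.
have [X eX] : exists X, X = v |: (L :\ f) by eexists.
have [Y eY] : exists Y, Y = E :\: (v |: L) by eexists.
have vf : v != f by apply: contraNneq vL => ->.
have efX : f |: X = v |: L by clear - eX Lf; set_dec.
have efY : f |: Y = E :\: (v |: (L :\ f)) by clear - eY fE Lf vf; set_dec.
have sX : X \subset ground (con [set f]) by rewrite /=; clear - eX sD sL vf;
  set_dec.
have sY : Y \subset ground (con [set f]) by rewrite /=; clear - eY Lf; set_dec.
have dXY : [disjoint X & Y] by clear - eX eY; set_dec.
have sE : ground (con [set f]) \subset X :|: Y by rewrite /=; clear - eX eY;
  set_dec.
have rXY : rk (con [set f]) X + rk (con [set f]) Y <= rk (con [set f]) (ground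
  (con [set f])) + 1.
  have := e X; have := e Y; have := e (ground (con [set f])).
  rewrite [in f |: ground _]/= setD1K // efX efY.
  rewrite (sline_out_rk hM hE dL (sline_outE dL) vL) -hD.
  by clear; lia.
have [s [Ls sf _]] := exists_other2 f f (sline_card dL).
have Xs : s \in X by rewrite eX !inE sf Ls orbT.
have NKs : rk (con [set f]) (s |: Y) != rk (con [set f]) Y.
  rewrite -eqSS !e setUCA efY spD ?(sline_cocE dL) // -hD.
  by clear; lia.
have cX : #|[set u in ground N | g u \in X]| <= 1.
  case: (small_side hN hN4 sX sY dXY sE rXY hr) => // cY; exfalso.
  have [injg gE gC gr] := hr.
  have c1 : #|[set u in ground N | g u == v]| <= 1.
    apply/card_le1_eqP=> u w; rewrite !inE =>
      /andP[Nu /eqP gu] /andP[Nw /eqP gw].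
    by apply: injg => //; rewrite gu gw.
  have c2 : #|[set u in ground N | g u \in L :\ f]| <= 1.
    apply/card_le1_eqP=> u w; rewrite !inE.
    move=> /andP[Nu /andP[guf Lgu]] /andP[Nw /andP[gwf Lgw]].
    apply/eqP; apply: contraT => wu; have uw : u != w by rewrite eq_sym.
    have := rk2 hN hN4 Nu Nw uw.
    have suw : [set u; w] \subset ground N by rewrite subUset !sub1set Nu.
    have sg : g @: [set u; w] :|: C \subset C :|: (L :\ f).
      by rewrite imsetU1 imset_set1 !subUset !sub1set subsetUl !inE guf Lgu gwf
        Lgw !orbT.
    have := gr _ suw; have := rk_mono (con [set f]) sg.
    have := rk_subU (con [set f]) (subxx (C :|: (L :\ f))).
    by have := e (L :\ f); rewrite setD1K // (sline_rk2 hM hE dL); clear; lia.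
  have : ground N \subset [set u in ground N | g u == v] :|:
      [set u in ground N | g u \in L :\ f] :|: [set u in ground N | g u \in Y].
    apply/subsetP=> u Nu; have := subsetP sE _ (gE u Nu).
    by rewrite eX !inE Nu /= -!orbA.
  move/subset_leq_card; rewrite !cardsU; clear - c1 c2 cY hN4; lia.
have [C' [g' [hr' C's]]] := realizes_through hN hN4 sX sY dXY sE rXY hr cX Xs
  NKs.
have hr2 := realizes_of_contract hr'.
apply/has_minor_contractP => //; exists (C' :|: [set f] :|: L), g'.
split; last exact: subsetUr.
apply: realizes_span hr2 _ => u Lu.
by apply: (line_span hM hE sL (sline_rk dL) Ls Lf sf) => //;
  rewrite rk_mem // !inE ?C's ?eqxx ?orbT.
Qed.

End WithMinor.

(** * From spore lines to segment-cosegment pairs *)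

Lemma card_swap (T : finType) (L : {set T}) (x v : T) :
  x \in L -> v \notin L -> #|v |: (L :\ x)| = #|L|.
Proof. by move=> Lx vL; rewrite cardsU1 !inE negb_and vL orbT (cardsD1 x L) Lx.
  Qed.

Section Line.
Variables (T : finType) (M : matroid T).
Local Notation E := (ground M).
Local Notation r := (rk M).
Hypotheses (hM : n_connected 3 M) (hE : 4 <= #|E|).
Implicit Types (X L : {set T}) (x v : T).
Local Notation spore_line := (spore_line M).

Lemma line_triangle L X : L \subset E -> r L <= 2 -> X \subset L -> #|X| = 3 ->
  triangle M X.
Proof.
move=> sL rL sX cX; rewrite /triangle cX eqxx andbT.
have sXE := subset_trans sX sL; have := rk_mono M sX => rX.
apply/minsetP; split; first by rewrite /dependent sXE cX; lia.
move=> B /andP[sB rB] sBX; apply/eqP; rewrite eqEcard sBX cX leqNgt;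
  apply/negP=> cB.
have [B0 | [b Bb]] := set_0Vmem B; first by rewrite B0 cards0 in rB.
have [c1 | c1] := leqP 2 #|B|.
  have [p [q [Bp Bq pq]]] := card_gt1P c1.
  have := @rk_mono _ M [set p; q] B ltac:(set_dec).
  rewrite (rk2 hM hE) ?(subsetP sB) //; clear - rB cB; lia.
have := @rk_mono _ M [set b] B; rewrite sub1set => /(_ Bb).
by rewrite (rk1 hM hE) ?(subsetP sB) //; clear - rB c1; lia.
Qed.

Lemma cl_line L (L0 : {set T}) x v : spore_line L x v -> L0 \subset L ->
  3 <= #|L0| -> cl M L0 = L.
Proof.
move=> dL sL0 c0; have sL := sline_sub dL; have sE := subset_trans sL0 sL.
have [p [q [Lp Lq pq]]] := card_gt1P (ltnW c0).
have rL0 : r L0 = 2.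
  have := @rk_mono _ M [set p; q] L0 ltac:(set_dec); have := rk_mono M sL0.
  rewrite (sline_rk2 hM hE dL) (rk2 hM hE) ?(subsetP sE) //; clear; lia.
apply/setP=> u; rewrite inE; apply/andP/idP=> [[uE /eqP spanu] | Lu].
  apply: (sline_flat dL) => //; exact: rk_span_mono sL0 spanu.
split; first exact: (subsetP sL).
by apply/eqP/(line_span hM hE sL (sline_rk dL) (subsetP sL0 p Lp) (subsetP sL0
  q Lq) pq) => //; apply: rk_mem.
Qed.

Hypothesis rE4 : 4 <= r E.

(** [L0] is [L] for (iv) and [L :\ e] for (iii); its closure is [L] in both cases. *)
Lemma sline_segment_cosegment L (L0 : {set T}) : L0 \subset L -> 3 <= #|L0| ->
  (forall y, y \in L0 -> exists v, spore_line L y v) ->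
  exists t (x y : 'I_t -> T), [/\ [set x i | i : 'I_t] = L0,
    segment_cosegment M x y & forall i, spore_line L (x i) (y i)].
Proof.
move=> sL0 c0 dL0.
pose vf y := odflt y [pick v | (v \notin L) && cocircuit M (v |: (L :\ y))].
have dvf y : y \in L0 -> spore_line L y (vf y).
  move=> Ly; have [v dv] := dL0 y Ly; rewrite /vf; case: pickP =>
    [w /andP[Lw cw] | ].
    by case: dv => ? ? ? ? ? _ _; split=> //; apply/cocircuitP.
  have cv : cocircuit M (v |: (L :\ y)) by apply/cocircuitP;
    apply: sline_coc dv.
  by move/(_ v); rewrite (sline_out dv) cv.
exists #|L0|, enum_val, (vf \o enum_val).
have eL : [set enum_val i | i : 'I_#|L0|] = L0.
  apply/setP=> u; apply/imsetP/idP=> [[i _ ->] | Lu]; first exact: enum_valP.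
  by exists (enum_rank_in Lu u); rewrite ?enum_rankK_in.
have [b Lb] : exists b, b \in L0 by apply/card_gt0P; lia.
have db := dvf b Lb; have sL := sline_sub db.
have dxy (i : 'I_#|L0|) : spore_line L (enum_val i) ((vf \o enum_val) i)
  by exact: dvf (enum_valP i).
split=> //; rewrite /segment_cosegment eL; split.
- exact: enum_val_inj.
- move=> i j eij; apply: enum_val_inj; apply/eqP; apply: contraT => nij.
  by have := sline_inj hM hE rE4 (dxy i) (dxy j) nij; rewrite eij eqxx.
- split=> //; first exact: subset_trans sL.
  move=> X sX; apply: line_triangle sL (sline_rk db) _; exact: subset_trans sL0.
- rewrite disjoint_sym disjoints_subset; apply/subsetP=> _ /imsetP[i _ ->].
  by rewrite inE; apply: contra (sline_out (dxy i)) => /(subsetP sL0).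
move=> i; rewrite (cl_line db sL0 c0); apply/cocircuitP;
  exact: sline_coc (dxy i).
Qed.

End Line.

(** * Assembly of the four outcomes *)

Theorem theorem1p2 (T U : finType) (M : matroid T) (N : matroid U)
    (hM : n_connected 3 M) (hN : n_connected 3 N) (hN4 : 4 <= #|ground N|)
    (Cstar : {set T}) (hC : cocircuit M Cstar)
    (hx0 : exists2 x0 : T, x0 \in Cstar & has_minor (contract M [set x0]) N) :
  (exists x : T,
     [/\ x \in Cstar, n_connected 3 (si (contract M [set x]))
       & has_minor (si (contract M [set x])) N])
  \/
  (exists x1 x2 x3 x4 : T,
     [/\ four_fan M x1 x2 x3 x4, x1 \in Cstar, x3 \in Cstar,
         n_connected 3 (si (contract M [set x2]))
       & has_minor (si (contract M [set x2])) N])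
  \/
  (exists (t : nat) (x y : 'I_t -> T) (e : T),
     let L := [set x i | i : 'I_t] in
     segment_cosegment M x y /\
     L \subset Cstar /\
     cl M L :\: L = [set e] /\
     e \notin Cstar /\
     n_connected 3 (si (contract M [set e])) /\
     has_minor (si (contract M [set e])) N /\
     n_connected 3 (contract M (cl M L)) /\
     has_minor (contract M (cl M L)) N /\
     (forall i : 'I_t,
        three_connected_up_to_unique_spore (contract M [set x i])
          (cl M L :\ x i) (y i)))
  \/
  (exists (t : nat) (x y : 'I_t -> T),
     let L := [set x i | i : 'I_t] in
     segment_cosegment M x y /\
     flat M L /\
     #|L :\: Cstar| <= 1 /\
     n_connected 3 (contract M L) /\
     has_minor (contract M L) N /\
     (forall i : 'I_t,
        three_connected_up_to_unique_spore (contract M [set x i])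
          (L :\ x i) (y i))).
Proof.
have N0 : 0 < #|ground N| by apply: leq_trans hN4.
have [x0 Cx0 mx0] := hx0; move/cocircuitP: hC => cC.
have hE : 4 <= #|ground M|.
  have /has_minorP := mx0 => /(_ N0)[C [g [injg gE _ _]]].
  apply: leq_trans hN4 _; rewrite -(card_in_imset injg).
  apply: subset_leq_card; apply/subsetP=> _ /imsetP[u Nu ->].
  by have := gE u Nu; rewrite inE => /andP[].
have sC : Cstar \subset ground M by case: cC.
pose good s := has_minor (contract M [set s]) N.
have good_si x : x \in ground M -> good x ->
  has_minor (si (contract M [set x])) N.
  move=> xE /(has_minorP _ N0)[C [g hr]].
  by apply: (si_minor _ hN hN4 hr) => u; apply: contract1_loopless.
have [|Ni] := classic (exists x : T, [/\ x \in Cstar,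
    n_connected 3 (si (contract M [set x])) & has_minor (si (contract M [set
      x])) N]).
  by left.
right; have [|Nii] := classic (exists x1 x2 x3 x4 : T,
     [/\ four_fan M x1 x2 x3 x4, x1 \in Cstar, x3 \in Cstar,
         n_connected 3 (si (contract M [set x2]))
       & has_minor (si (contract M [set x2])) N]); first by left.
right.
have vertical3_ex x : x \in ground M -> ~ n_connected 3 (si (contract M [set
  x])) ->
    exists X Y, vertical3 M X x Y.
  move=> xE Nc; apply: NNPP => Nv3; apply: Nc; apply: si_connected => // X Y h.
  by apply: Nv3; exists X, Y.
have good_vertical3 x : x \in Cstar -> good x ->
  exists X Y, vertical3 M X x Y /\
    forall s, s \in X -> rk M (s |: Y) != rk M Y -> good s.
  move=> Cx gx; have xE := subsetP sC x Cx.
  have [|X [Y h]] := vertical3_ex x xE.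
    by move=> c; apply: Ni; exists x; split=> //; apply: good_si.
  exact: (vertical3_side hM hE hN hN4 h gx).
(* The two sides of a vertical 3-partition have ranks at least 3 with sum r E + 2. *)
have rE4 : 4 <= rk M (ground M).
  have [X [Y [[_ _ _ _ _ _ rXY rX rY] _]]] := good_vertical3 x0 Cx0 mx0.
  by clear - rXY rX rY; lia.
have no_fan L y v b v' : spore_line M L y v' -> L = [set y; v; b] ->
    y \in Cstar -> b \in Cstar -> good v ->
      (forall Y1 Y2, ~ vertical3 M Y1 v Y2) -> False.
  move=> dL eL Cy Cb gv Nv3; apply: Nii; exists y, v, b, v'.
  have sL := sline_sub dL; have Lv : v \in L by rewrite eL !inE eqxx orbT.
  have vE := subsetP sL v Lv; have c3 := sline_card dL;
    have v'L := sline_out dL.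
  have [yv yb vb] : [/\ y != v, y != b & v != b].
    move: c3; rewrite eL -setUA !cardsU1 cards1 !inE negb_or.
    by case: eqP; case: eqP; case: eqP.
  have c3e : #|L| = 3.
    by rewrite eL -setUA !cardsU1 cards1 !inE negb_or yv yb vb.
  have eD : v' |: (L :\ y) = [set v; b; v'].
    by rewrite eL in v'L *; clear - yv yb vb v'L; set_dec.
  split=> //; [| exact: si_connected | exact: good_si].
  apply/and3P; split.
  - move: v'L; rewrite eL !inE !negb_or /= !inE !negb_or yv yb vb /= =>
      /andP[/andP[v'y v'v] v'b].
    by rewrite !andbT ![_ == v']eq_sym v'y v'v v'b.
  - by rewrite -eL; apply: (line_triangle hM hE sL (sline_rk dL)).
  rewrite /triad -eD; apply/andP; split; first exact/cocircuitP/(sline_coc dL).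
  by rewrite card_swap ?c3e // (sline_in dL).
have [L [f Lf [Cf gf]] dLC] := exists_line hM hE cC good_vertical3 no_fan Cx0
  mx0.
have [vf0 df] := dLC f Lf Cf.
have sL := sline_sub df; have cL := sline_card df; have rL := sline_rk df.
have mL : has_minor (contract M L) N := contract_line_minor hM hE hN hN4 df gf.
have good_L e : e \in L -> good e.
  by move=> Le; apply: (has_minor_contract_sub hN4 sL) mL; rewrite sub1set.
have outC e u : e \in L -> e \notin Cstar -> u \in L -> u != e -> u \in Cstar.
  move=> Le Ce Lu ue; have := line_cocirc hM hE cC sL rL Lu Le ue Lf Cf.
  by rewrite (negPf Ce) orbF.
have three (A : {set T}) : 3 <= #|A| -> exists a b c : T, [/\ a \in A, b \in A,
  c \in A & [/\ a != b, a != c & b != c]].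
  move=> /card_gt2P[a [b [c [[Aa Ab Ac] [ab bc ca]]]]].
  by exists a, b, c; split=> //; split=> //; rewrite eq_sym.
have pair2 (A : {set T}) g : 3 <= #|A| -> exists a b : T, [/\ a \in A, b \in A,
  a != b, g != a & g != b].
  move=> c3; have [a [Aa ag _]] := exists_other2 g g c3;
    have [b [Ab bg ba]] := exists_other2 g a c3.
  by exists a, b; split=> //; rewrite eq_sym.
have conn_L (A : {set T}) : A \subset L -> 3 <= #|A| -> (forall y, y \in A ->
  exists v, spore_line M L y v) ->
    n_connected 3 (contract M L).
  move=> sA c3 dA; have [a [b [c [Aa Ab Ac [ab ac bc]]]]] := three A c3.
  have [va da] := dA a Aa; have [vb db] := dA b Ab; have [vc dc] := dA c Ac.
  exact: (contract_line_conn hM hE da db dc ab ac bc).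
have spores (A : {set T}) : A \subset L -> 3 <= #|A| -> (forall y, y \in A ->
  exists v, spore_line M L y v) ->
    forall g a, g \in A -> spore_line M L g a ->
    three_connected_up_to_unique_spore (contract M [set g]) (L :\ g) a.
  move=> sA c3 dA g a Ag dg; have [x [x' [Ax Ax' xx' gx gx']]] := pair2 A g c3.
  have [v dx] := dA x Ax; have [v' dx'] := dA x' Ax'.
  exact: (unique_spore hM hE rE4 dx dx' xx' dg gx gx').
have [[e [Le [Ce Ne]]] | Ne] := classic (exists e, e \in L /\ (e \notin Cstar /\
    ~ exists v, spore_line M L e v)).
  have eE := subsetP sL e Le.
  (* A vertical 3-partition at [e] would give [e] a partner, because two other points of [L] have
     one. *)
  have ce : n_connected 3 (si (contract M [set e])).
    apply: NNPP => /(vertical3_ex e eE)[X [Y h]]; apply: Ne.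
    have [x [x' [Lx Lx' xx' ex ex']]] := pair2 L e cL.
    have xe : x != e by rewrite eq_sym. have x'e : x' != e by rewrite eq_sym.
    have [v dx] := dLC x Lx (outC e x Le Ce Lx xe).
    have [v' dx'] := dLC x' Lx' (outC e x' Le Ce Lx' x'e).
    by have [a da _] := two_slines_vertical3 hM hE dx dx' xx' Le ex ex' h;
      exists a.
  have dA y : y \in L :\ e -> exists v, spore_line M L y v.
    by case/setD1P=> ye Ly; apply: dLC (outC e y Le Ce Ly ye).
  have sA : L :\ e \subset L by apply: subsetDl.
  have cA : #|L| = (#|L :\ e|).+1 by rewrite (cardsD1 e L) Le.
  (* With only two points besides [e], the line is a triangle; with the partner of [x] it forms a
     fan around [e], which is (ii). *)
  have [c3 | c3] := leqP 3 #|L :\ e|; last first.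
    exfalso; apply: Nii.
    have [x [x' [Lx Lx' xx' ex ex']]] := pair2 L e cL.
    have xe : x != e by rewrite eq_sym. have x'e : x' != e by rewrite eq_sym.
    have Cx := outC e x Le Ce Lx xe; have Cx' := outC e x' Le Ce Lx' x'e.
    have [v dx] := dLC x Lx Cx; exists x, e, x', v.
    have vL := sline_out dx.
    have cL3 : #|L| = 3 by clear - cA c3 cL; lia.
    have eL : [set x; e; x'] = L.
      apply/eqP; rewrite eqEcard cL3 !subUset !sub1set Lx Le Lx' /=.
      by rewrite -setUA !cardsU1 cards1 !inE negb_or xe xx' ex'.
    have eD : v |: (L :\ x) = [set e; x'; v].
      by rewrite -eL; clear - xe xx'; set_dec.
    split=> //; last exact: good_si (good_L e Le).
    apply/and3P; split.
    - move: vL; rewrite -eL !inE !negb_or /= !inE !negb_or xe xx' ex' /= =>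
        /andP[/andP[vx ve] vx'].
      by rewrite !andbT ![_ == v]eq_sym vx ve vx'.
    - by rewrite eL; apply: (line_triangle hM hE sL rL).
    rewrite /triad -eD; apply/andP; split;
      first exact/cocircuitP/(sline_coc dx).
    by rewrite card_swap ?cL3.
  left; have [t [x [y [eL sc dxy]]]] := sline_segment_cosegment hM hE rE4 sA c3
    dA.
  exists t, x, y, e; rewrite /= eL.
  have clL := cl_line hM hE df sA c3.
  split=> //; split.
    by apply/subsetP=> u /setD1P[ue Lu]; apply: outC Le Ce Lu ue.
  split; first by rewrite clL; clear - Le; set_dec.
  split=> //; split=> //; split; first exact: good_si (good_L e Le).
  rewrite clL; split; first exact: conn_L sA c3 dA.
  split=> // i; apply: (spores (L :\ e)) => //.
  by rewrite -eL; apply: imset_f.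
have dL y : y \in L -> exists v, spore_line M L y v.
  move=> Ly; have [|Cy] := boolP (y \in Cstar); first exact: dLC.
  by apply: NNPP => Nv; apply: Ne; exists y.
right; have [t [x [y [eL sc dxy]]]] := sline_segment_cosegment hM hE rE4 (subxx
  L) cL dL.
exists t, x, y; rewrite /= eL; split=> //; split.
  by rewrite /flat sL (cl_line hM hE df (subxx L) cL) eqxx.
split.
  apply/card_le1_eqP=> u w /setDP[Lu Cu] /setDP[Lw Cw]; apply/eqP.
  by apply: contraT => wu; rewrite (outC u w Lu Cu Lw wu) in Cw.
split; first exact: conn_L (subxx L) cL dL.
split=> // i; apply: (spores L) => //.
by rewrite -eL; apply: imset_f.
Qed.
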